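(* Let $Y\subset \mathbb{P}^n$ be an integral curve such that $Y\nsubseteq \Delta_{n-1}$ and $Y$ is not contained in a binomial hypersurface. Then all Hadamard secant products of $Y$ have the expected dimension, i.e. for every integer $k\ge 1$ the Hadamard product $Y^{\star k}:=Y\star\cdots\star Y$ of $k$ copies of $Y$ satisfies $$\dim Y^{\star k}=\min\{n,k\}.$$
   Context: $\mathbb{P}^n$ is the $n$-dimensional complex projective space with a fixed system of homogeneous coordinates $x_0,\dots ,x_n$. Set $H_i:=\{x_i=0\}$ for $i=0,\dots ,n$ and $\Delta_{n-1}:=H_0\cup\cdots\cup H_n$ (the union of all coordinate hyperplanes). Varieties here are closed subvarieties of $\mathbb{P}^n$. A binomial hypersurface is the zero locus in $\mathbb{P}^n$ of a homogeneous binomial $\alpha\, x_0^{a_0}\cdots x_n^{a_n}+\beta\, x_0^{b_0}\cdots x_n^{b_n}$, where $\alpha,\beta$ are arbitrary non-zero constants and the two monomials are distinct and of the same degree. Hadamard product of points: for $P=[p_0:\dots :p_n]$ and $Q=[q_0:\dots :q_n]$ in $\mathbb{P}^n$ with $p_iq_i\ne 0$ for at least one $i$, $P\star Q:=[p_0q_0:\dots :p_nq_n]\in\mathbb{P}^n$; if $p_iq_i=0$ for all $i$, $P\star Q$ is not defined. For $k$ points the product is coordinatewise in the same way, and is well-defined when some coordinate of the product is non-zero. Hadamard product of varieties: let $X_1,\dots ,X_k\subset\mathbb{P}^n$ be irreducible subvarieties such that $P_1\star\cdots\star P_k$ is well-defined for at least one $(P_1,\dots ,P_k)\in X_1\times\cdots\times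 X_k$. Then $X_1\star\cdots\star X_k$ is the Zariski closure in $\mathbb{P}^n$ of the set of all well-defined products $P_1\star\cdots\star P_k$ with $P_j\in X_j$. For $k=1$ it is $X_1$ itself. The Hadamard secant products of $Y$ are the products $Y\star\cdots\star Y$ of $k$ copies of $Y$; the expected dimension is $\min\{n,k\cdot\dim Y\}=\min\{n,k\}$. *)

(* Defs.v *)
(* R[i], for R : realType, is the field of complex numbers. *)
From mathcomp Require Import all_boot all_order all_algebra.
From mathcomp Require Import generic_quotient.
From mathcomp Require Import boolp classical_sets reals complex.
From mathcomp Require Import mpoly.

Set Implicit Arguments.
Unset Strict Implicit.
Unset Printing Implicit Defensive.

Import GRing.Theory.
Local Open Scope classical_set_scope.
Local Open Scope ring_scope.
Local Open Scope quotient_scope.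

Definition nzvec (R : realType) (n : nat) := {v : 'rV[R[i]]_n.+1 | v != 0}.

Definition proportional (R : realType) (n : nat) (u v : nzvec R n) : bool :=
  `[< exists2 c : R[i], c != 0 & val v = c *: val u >].

Lemma proportional_is_equiv (R : realType) (n : nat) :
  equiv_class_of (@proportional R n).
Proof.
split=> [u|u v|v u w].
- by apply/asboolP; exists 1; [exact: oner_neq0 | rewrite scale1r].
- have sym (x y : nzvec R n) : proportional x y -> proportional y x.
    move=> /asboolP[c c0 e]; apply/asboolP; exists c^-1; first by rewrite invr_eq0.
    by rewrite e scalerA mulVf // scale1r.
  by apply/idP/idP; exact: sym.
- move=> /asboolP[c c0 e] /asboolP[d d0 e']; apply/asboolP.
  by exists (d * c); [rewrite mulf_neq0 | rewrite e' e scalerA].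
Qed.

Canonical proportional_equiv (R : realType) (n : nat) :=
  EquivRelPack (@proportional_is_equiv R n).
Canonical proportional_encModRel (R : realType) (n : nat) :=
  defaultEncModRel (@proportional R n).

(* Complex projective n-space: nonzero vectors up to nonzero scalars. *)
Definition Pn (R : realType) (n : nat) : Type := {eq_quot (@proportional R n)}.

(* Coordinates of a chosen representative; below they are only used in ways
   that do not depend on the choice (see [homog_vanish_pi], [hadamard_pi]). *)
Definition hcoord (R : realType) (n : nat) (P : Pn R n) (i : 'I_n.+1) : R[i] :=
  val (repr P) 0 i.

Definition homogeneous (R : realType) (n : nat) (f : {mpoly R[i][n.+1]}) : Prop :=
  exists d : nat, f \is d.-homog.

(* Meaningful when every element of S is homogeneous. *)
Definition zero_locus (R : realType) (n : nat) (S : set {mpoly R[i][n.+1]}) :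
    set (Pn R n) :=
  [set P | forall f, S f -> f.@[hcoord P] = 0].

Definition zariski_closed (R : realType) (n : nat) (X : set (Pn R n)) : Prop :=
  exists2 S : set {mpoly R[i][n.+1]},
    S `<=` @homogeneous R n & X = zero_locus S.

Definition zariski_closure (R : realType) (n : nat) (A : set (Pn R n)) :
    set (Pn R n) :=
  [set P | forall Z, zariski_closed Z -> A `<=` Z -> Z P].

Definition irreducible_closed (R : realType) (n : nat) (X : set (Pn R n)) : Prop :=
  [/\ zariski_closed X, X !=set0 &
      forall Z1 Z2, zariski_closed Z1 -> zariski_closed Z2 ->
        X `<=` Z1 `|` Z2 -> X `<=` Z1 \/ X `<=` Z2].

(* Z 0, ..., Z d is a strictly increasing chain of irreducible closed subsets
   of X; the values Z i for i > d are irrelevant. *)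
Definition irreducible_chain (R : realType) (n : nat) (X : set (Pn R n))
    (d : nat) (Z : nat -> set (Pn R n)) : Prop :=
  [/\ forall i, (i <= d)%N -> irreducible_closed (Z i),
      forall i, (i < d)%N -> Z i `<` Z i.+1 &
      Z d `<=` X].

(* The (nonempty, closed) set X has Krull dimension d in the Zariski
   topology. *)
Definition has_dim (R : realType) (n : nat) (X : set (Pn R n)) (d : nat) : Prop :=
  (exists Z, irreducible_chain X d Z) /\
  (forall e Z, irreducible_chain X e Z -> (e <= d)%N).

Definition integral_curve (R : realType) (n : nat) (Y : set (Pn R n)) : Prop :=
  irreducible_closed Y /\ has_dim Y 1.

Definition coord_hyperplane (R : realType) (n : nat) (i : 'I_n.+1) : set (Pn R n) :=
  [set P | hcoord P i = 0].

Definition coord_hyperplanes (R : realType) (n : nat) : set (Pn R n) :=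
  \bigcup_(i in [set: 'I_n.+1]) @coord_hyperplane R n i.

Definition binomial_hypersurface (R : realType) (n : nat) (B : set (Pn R n)) : Prop :=
  exists (alpha beta : R[i]) (a b : 'X_{1..n.+1}),
    [/\ alpha != 0, beta != 0, a != b, mdeg a = mdeg b &
        B = zero_locus [set alpha *: 'X_[a] + beta *: 'X_[b]]].

(* P_1 * ... * P_k, equal to None when all the coordinatewise products vanish,
   i.e. when the product is not defined. *)
Definition hadamard (R : realType) (n k : nat) (P : 'I_k -> Pn R n) :
    option (Pn R n) :=
  omap (fun v : nzvec R n => \pi_(Pn R n) v)
       (insub (\row_i \prod_(j < k) hcoord (P j) i)).

Definition hadamard_product (R : realType) (n k : nat) (X : 'I_k -> set (Pn R n)) :
    set (Pn R n) :=
  zariski_closure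
    [set Q | exists2 P : 'I_k -> Pn R n, forall j, X j (P j) & hadamard P = Some Q].

Definition hadamard_power (R : realType) (n : nat) (Y : set (Pn R n)) (k : nat) :
    set (Pn R n) :=
  hadamard_product (fun _ : 'I_k => Y).

Lemma hcoord_pi (R : realType) (n : nat) (v : nzvec R n) :
  exists2 c : R[i], c != 0 &
    forall i, hcoord (\pi_(Pn R n) v) i = c * val v 0 i.
Proof.
have /asboolP[c c0 e] : proportional v (repr (\pi_(Pn R n) v)).
  by apply/eqmodP; rewrite reprK.
by exists c => // i; rewrite /hcoord e mxE.
Qed.

Lemma homog_vanish_pi (R : realType) (n : nat) (f : {mpoly R[i][n.+1]})
    (v : nzvec R n) : homogeneous f ->
  f.@[hcoord (\pi_(Pn R n) v)] = 0 <-> f.@[fun i => val v 0 i] = 0.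
Proof.
move=> [d /dhomogP fd]; have [c c0 e] := hcoord_pi v.
have -> : f.@[hcoord (\pi_(Pn R n) v)] = c ^+ d * f.@[fun i => val v 0 i].
  rewrite !mevalE big_distrr /=; rewrite big_seq [RHS]big_seq.
  apply: eq_bigr => m mf; rewrite [RHS]mulrCA; congr (_ * _).
  have <- : mdeg m = d := fd m mf.
  rewrite mdegE -prodrXr -big_split /=; apply: eq_bigr => i _.
  by rewrite e exprMn.
split=> [/eqP|->]; last by rewrite mulr0.
by rewrite mulf_eq0 expf_eq0 (negPf c0) andbF /= => /eqP.
Qed.

Lemma hadamard_pi (R : realType) (n k : nat) (v : 'I_k -> nzvec R n) :
  hadamard (fun j => \pi_(Pn R n) (v j)) =
  omap (fun w : nzvec R n => \pi_(Pn R n) w)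
       (insub (\row_i \prod_(j < k) val (v j) 0 i)).
Proof.
rewrite /hadamard.
have [c c0 e] : exists2 c : R[i], c != 0 &
    \row_i \prod_(j < k) hcoord (\pi_(Pn R n) (v j)) i =
    c *: \row_i \prod_(j < k) val (v j) 0 i.
  have /choice[c ce] : forall j, exists c : R[i], c != 0 /\
      forall i, hcoord (\pi_(Pn R n) (v j)) i = c * val (v j) 0 i.
    by move=> j; have [c c0 e] := hcoord_pi (v j); exists c.
  exists (\prod_j c j); first by apply/prodf_neq0 => j _; have [] := ce j.
  apply/rowP=> i; rewrite !mxE -big_split /=; apply: eq_bigr => j _.
  by have [_ ->] := ce j.
rewrite e; case: insubP => [w _ we|]; case: insubP => [u _ ue|] //=.
- congr Some; apply/esym/eqmodP/asboolP; exists c => //.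
  by rewrite we ue.
- move=> /negPn/eqP z; have := valP w; rewrite /= we z scaler0 eqxx //.
- rewrite negbK scaler_eq0 (negPf c0) /= => /eqP z.
  by have := valP u; rewrite /= ue z eqxx.
Qed.

(* Main.v *)
Require Import Defs.
From mathcomp Require Import all_boot all_order all_algebra.
From mathcomp Require Import finmap boolp classical_sets cardinality.
From mathcomp Require Import reals complex mpoly zify ring lra.

Set Implicit Arguments.
Unset Strict Implicit.
Unset Printing Implicit Defensive.

Import Order.TTheory GRing.Theory Num.Theory.
Local Open Scope classical_set_scope.
Local Open Scope ring_scope.

(** Both bounds on the dimension come from Hilbert functions, that is from the
number of linearly independent restrictions of forms of degree [d].

Upper bounds.  Let [Z 0], ..., [Z e] be a strictly increasing chain of
irreducible closed sets.  Choose forms [F i] of one common degree such that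
[F i] vanishes on [Z (i - 1)] but not on [Z i].  The monomials of a given degree
in [F 0], ..., [F e] are linearly independent on [Z e], so the Hilbert function
of [Z e] grows at least like [d ^ e] ([chain_length_le_growth]).  That of the
projective space grows like [d ^ n], and that of the k-th Hadamard power of [Y]
at most like the k-th power of that of [Y], since a monomial at a coordinatewise
product is the product of its values ([spanned_growth_pow]).

It remains to see that the Hilbert function of [Y] is at most linear
([curve_spanned_growth]), knowing only that chains in [Y] have length at most 1.
Proper closed subsets of [Y] are finite, for an infinite one would contain a
minimal infinite one, which is irreducible ([proper_closed_finite]).  So there
are two linear forms without common zero on [Y]: a coordinate and a form that is
nonzero at its finitely many zeros.  By the Nullstellensatz, proved here from the
uncountability of the complex numbers ([nullstellensatz]), the coordinate ring of
[Y] is a finite module over the polynomials in these two forms, and forms of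
degree [d] in two variables have dimension [d + 1] ([finite_module_growth]).

Lower bound.  Let [p] be a point of [Y] off the coordinate hyperplanes.  The
closures of the sets [p^(k - j) * Y^j], where products are coordinatewise, are
irreducible and increase with [j] from a point to the k-th Hadamard power.
Let [M = p^-1 * Y]; it contains the point with all coordinates 1.  If two
successive sets have the same closure, the forms vanishing on [M^j] are stable
under multiplication of the variables by the coordinates of a point of [M].
Monomials of one degree are distinct characters on [M], as [Y] lies in no
binomial hypersurface, so by Dedekind's independence of characters no nonzero
form vanishes on [M^j] ([dedekind_independence]).  Hence the chain is strict
until it fills the projective space; by the upper bounds this happens exactly at
[j = n], if [n <= k] ([hadamard_power_chain]). *)

(** * Linear relations and descending chains *)

Lemma linear_dependence (K : fieldType) (I S : finType) (A : I -> S -> K) :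
  (#|S| < #|I|)%N ->
  exists2 c : I -> K, exists i, c i != 0 & forall s, \sum_i c i * A i s = 0.
Proof.
move=> SI.
pose B := \matrix_(i < #|I|, s < #|S|) A (enum_val i) (enum_val s).
have /rowV0Pn[u /sub_kermxP uB u0] : kermx B != 0.
  rewrite kermx_eq0 -row_leq_rank -ltnNge.
  exact: leq_ltn_trans (rank_leq_col _) SI.
exists (fun i => u 0 (enum_rank i)) => [|s].
  have /rV0Pn[i ui] := u0; exists (enum_val i); by rewrite enum_valK.
have us : \sum_(j < #|I|) u 0 j * A (enum_val j) s = 0.
  have := congr1 (fun M : 'rV_ _ => M 0 (enum_rank s)) uB; rewrite !mxE => us.
  by rewrite -[RHS]us; apply: eq_bigr => i _; rewrite mxE enum_rankK.
rewrite -[RHS]us (reindex_onto enum_val enum_rank) /=; last first.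
  by move=> i _; rewrite enum_rankK.
apply: eq_big => [i|i _]; last by rewrite enum_valK.
by rewrite enum_valK eqxx.
Qed.

(** Choose repeatedly an index at which the tail of the sequence is minimal. *)
Lemma nat_nondecreasing_subsequence (f : nat -> nat) :
  exists2 g : nat -> nat, {homo g : i j / (i < j)%N} &
    forall i j, (i <= j)%N -> (f (g i) <= f (g j))%N.
Proof.
have tail_min N : exists m, (N <= m)%N /\ forall j, (N <= j)%N -> (f m <= f j)%N.
  have ex : exists y, `[< exists2 m, (N <= m)%N & f m = y >].
    by exists (f N); apply/asboolP; exists N.
  case: (ex_minnP ex) => y /asboolP[m Nm <-] ymin.
  exists m; split=> // j Nj; apply: ymin; apply/asboolP; by exists j.
have [h hP] := choice tail_min.
pose g := fix g i := if i is j.+1 then h (g j).+1 else h 0%N.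
have gS i : (g i < g i.+1)%N by have [] := hP (g i).+1.
have ghomo : {homo g : i j / (i < j)%N} by apply: homo_ltn gS; exact: ltn_trans.
exists g => // i j; rewrite leq_eqVlt => /predU1P[->//|/ghomo gij].
case: i gij => [|i] gij; first by have [_] := hP 0%N; apply.
have [_] := hP (g i).+1; apply; exact: leq_trans (gS _) (ltnW gij).
Qed.

(** Dickson's lemma: pass to a subsequence on which one more coordinate is
nondecreasing, for each coordinate in turn. *)
Lemma dickson (n : nat) (m : nat -> 'X_{1..n}) :
  exists i j, (i < j)%N /\ (m i <= m j)%MM.
Proof.
suff [g gh gm] : exists2 g : nat -> nat, {homo g : i j / (i < j)%N} &
    forall x, x \in enum 'I_n -> forall i j, (i <= j)%N -> (m (g i) x <= m (g j) x)%N.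
  exists (g 0%N), (g 1%N); split; first exact: gh.
  by apply/mnm_lepP => x; apply: gm; rewrite ?mem_enum.
elim: (enum 'I_n) => [|x s [g gh gm]]; first by exists id.
have [h hh hm] := nat_nondecreasing_subsequence (fun i => m (g i) x).
exists (g \o h) => [i j ij|y]; first exact/gh/hh.
rewrite inE => /predU1P[->|ys] i j ij /=; first exact: hm.
apply: gm => //; move: ij; rewrite leq_eqVlt => /predU1P[->//|/hh /ltnW //].
Qed.

(** The polynomial [f] is zero at every vector of [M]; since [M] is any set of
vectors, it plays the role of the affine cone over a projective set. *)
Definition vanishes (K : fieldType) (n : nat) (M : set ('I_n -> K)) (f : {mpoly K[n]}) :=
  forall v, M v -> f.@[v] = 0.

(** The descending chain condition, as in the basis theorem: let [f i] be a
polynomial of minimal leading monomial among those vanishing on [M i.+1] but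
not on [M i].  By Dickson's lemma some leading monomial divides a later one,
and subtracting a multiple of [f i] from [f j] contradicts the minimality. *)
Lemma descending_vanishing_sets (K : fieldType) (n : nat) (M : nat -> set ('I_n -> K)) :
  (forall i, M i.+1 `<=` M i) ->
  ~ (forall i, exists2 f, vanishes (M i.+1) f & ~ vanishes (M i) f).
Proof.
move=> Mdec ex.
have Mle i j : (i <= j)%N -> M j `<=` M i.
  move=> ij; rewrite -(subnKC ij); elim: (j - i)%N => [|k IH]; first by rewrite addn0.
  by rewrite addnS; apply: subset_trans IH; exact: Mdec.
have /choice[f fP] : forall i, exists f : {mpoly K[n]},
    [/\ vanishes (M i.+1) f, ~ vanishes (M i) f &
    forall g, vanishes (M i.+1) g -> ~ vanishes (M i) g -> ~~ (mlead g < mlead f)%O].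
  move=> i; have [f fv fnv] := ex i.
  have [m mf] : exists m, mlead f = m by exists (mlead f).
  elim/(@ltmwf n): m f fv fnv mf => m IH f fv fnv mf.
  have [[g [gv gnv gf]]|no] := EM (exists g, [/\ vanishes (M i.+1) g, ~ vanishes (M i) g &
    (mlead g < mlead f)%O]).
    by apply: IH (erefl (mlead g)) => //; rewrite -mf.
  exists f; split=> // g gv gnv; apply/negP => gf; apply: no; by exists g.
have [i [j [ij mij]]] := dickson (fun i => mlead (f i)).
have [fiv _ _] := fP i; have [fjv fjnv fjmin] := fP j.
have fi0 : f i != 0.
  by apply/eqP => fi0; have [_ + _] := fP i; apply => v _; rewrite fi0 meval0.
have fj0 : f j != 0 by apply/eqP => fj0; apply: fjnv => v _; rewrite fj0 meval0.
pose q := (mleadc (f j) / mleadc (f i)) *: 'X_[mlead (f j) - mlead (f i)].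
have qf0 : mleadc (f j) / mleadc (f i) != 0 by rewrite mulf_neq0 ?invr_eq0 ?mleadc_eq0.
have q0 : q != 0.
  by rewrite -mleadc_eq0 mleadZ // mleadXm mcoeffZ mcoeffX eqxx mulr1.
have qlead : mlead (q * f i) = mlead (f j).
  by rewrite mleadM // mleadZ // mleadXm submK.
have qfv v : M j v -> (q * f i).@[v] = 0.
  by move=> Mv; rewrite mevalM fiv ?mulr0 //; apply: Mle Mv.
pose g := f j - q * f i.
have gv : vanishes (M j.+1) g.
  by move=> v Mv; rewrite mevalB fjv // qfv ?subr0 //; exact: Mdec.
have gnv : ~ vanishes (M j) g.
  move=> gv0; apply: fjnv => v Mv; have := gv0 v Mv.
  by rewrite mevalB qfv // subr0.
have g0 : g != 0 by apply/eqP => g0; apply: gnv => v _; rewrite g0 meval0.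
have /negP := fjmin g gv gnv; apply.
have le : (mlead g <= mlead (f j))%O.
  by apply: le_trans (mleadB_le _ _) _; rewrite qlead joinxx.
rewrite lt_neqAle le andbT; apply/eqP => gl.
have : mleadc g = 0; last by apply/eqP; rewrite mleadc_eq0.
rewrite gl mcoeffB -{2}qlead mleadM // mleadcM mleadZ // mleadXm mcoeffZ mcoeffX eqxx mulr1.
by rewrite divfK ?subrr // mleadc_eq0.
Qed.

(** * The Nullstellensatz over an uncountable field *)

(** Ideals as sets of polynomials; the unit ideal is allowed. *)
Definition is_ideal (K : fieldType) (n : nat) (J : set {mpoly K[n]}) :=
  [/\ J 0, forall f g, J f -> J g -> J (f + g) & forall h f, J f -> J (h * f)].

(** Among the ideals containing [J] and no power of [g] there is a maximal one,
[M]; each element [a] outside [M] then divides a power of [g] modulo [M]. *)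
Lemma maximal_ideal_avoiding_powers (K : fieldType) (n : nat) (J : set {mpoly K[n]}) g :
  is_ideal J -> (forall N, ~ J (g ^+ N)) ->
  exists M : set {mpoly K[n]}, [/\ J `<=` M, is_ideal M, forall N, ~ M (g ^+ N) &
    forall a, ~ M a -> exists N u, M (u * a - g ^+ N)].
Proof.
move=> Jid Jg.
pose good (A : set {mpoly K[n]}) := [/\ J `<=` A, is_ideal A & forall N, ~ A (g ^+ N)].
have Jgood : good J by split.
(* The empty set is admitted only because it is the union of the empty chain. *)
have [F Fgood Ftot|M [[->|[JM [M0 MD MM] Mg]] Mmax]] :=
    @Zorn_bigcup _ [set A | A = set0 \/ good A].
- have [[A FA A0]|no] := EM (exists2 A, F A & A != set0); last first.
    left; rewrite -subset0 => f [A FA Af]; apply: no; exists A => //.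
    by apply/set0P; exists f.
  have gA B : F B -> B != set0 -> good B.
    by move=> /Fgood[->|//]; rewrite eqxx.
  have nz (B : set {mpoly K[n]}) f : B f -> B != set0 by move=> Bf; apply/set0P; exists f.
  right; have [JA [A00 _ _] _] := gA _ FA A0; split.
  + by move=> f Jf; exists A => //; exact: JA.
  + split; first by exists A.
    * move=> f h [B FB Bf] [C FC Ch].
      have [_ [_ BD _] _] := gA _ FB (nz _ _ Bf); have [_ [_ CD _] _] := gA _ FC (nz _ _ Ch).
      have [BC|CB] := Ftot _ _ FB FC.
        by exists C => //; apply: CD => //; exact: BC.
      by exists B => //; apply: BD => //; exact: CB.
    * move=> h f [B FB Bf]; exists B => //.
      by have [_ [_ _ BM] _] := gA _ FB (nz _ _ Bf); apply: BM.
  + by move=> N [B FB Bg]; have [_ _ /(_ N)] := gA _ FB (nz _ _ Bg).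
- have [] := Mmax J; last by right.
  by split=> // /(_ 0); case: Jid => J0 _ _; apply.
exists M; split=> // a Ma.
have MN f : M f -> M (- f) by rewrite -mulN1r; exact: MM.
pose B := [set f | exists u, M (f - u * a)].
have [[N [u Mu]]|no] := EM (exists N, B (g ^+ N)).
  by exists N, u; rewrite -opprB; exact: MN.
have [] := Mmax B.
  split=> [f Mf|/(_ a)]; first by exists 0; rewrite mul0r subr0.
  by move=> /[dup] + _; apply: contra_not Ma; apply; exists 1; rewrite mul1r subrr.
right; split.
- by move=> f /JM Mf; exists 0; rewrite mul0r subr0.
- split; first by exists 0; rewrite mul0r subr0.
  + move=> f h [u Mu] [v Mv]; exists (u + v); rewrite mulrDl opprD addrACA; exact: MD.
  + by move=> h f [u Mu]; exists (h * u); rewrite -mulrA -mulrBr; exact: MM.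
- by move=> N BN; apply: no; exists N.
Qed.

(** In this section [M] is an ideal that contains no power of [g] and is maximal
for this property. *)
Section Nullstellensatz.
Variables (K : closedFieldType) (n : nat).
Hypothesis K_uncountable : forall h : K -> nat, exists y, infinite_set (h @^-1` [set y]).
Variables (g : {mpoly K[n]}) (M : set {mpoly K[n]}).
Hypotheses (Mid : is_ideal M) (Mg : forall N, ~ M (g ^+ N)).
Hypothesis Mmax : forall a, ~ M a -> exists N u, M (u * a - g ^+ N).

Lemma maximal_ideal_prime a b : M (a * b) -> M a \/ M b.
Proof.
have [M0 MD MM] := Mid => Mab.
have [|Ma] := EM (M a); first by left.
have [|Mb] := EM (M b); first by right.
have [N [u uP]] := Mmax Ma; have [N' [v vP]] := Mmax Mb.
case: (Mg (N := (N + N')%N)).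
have -> : g ^+ (N + N') = (u * v) * (a * b) +
    (- (v * b)) * (u * a - g ^+ N) + (- g ^+ N) * (v * b - g ^+ N').
  by rewrite exprD; ring.
by apply: (MD); [apply: (MD)|]; apply: MM.
Qed.

Lemma maximal_ideal_contains_factor (I : Type) (r : seq I) (F : I -> {mpoly K[n]}) :
  M (\prod_(i <- r) F i) -> exists i, M (F i).
Proof.
elim: r => [|i r IH]; first by rewrite big_nil => M1; case: (Mg (N := 0)).
by rewrite big_cons => /maximal_ideal_prime[|/IH//]; exists i.
Qed.

(** If no ['X_j - a] lay in [M], there would be, for every [a], a polynomial
[u a] with [u a * ('X_j - a)] equal to a power of [g] modulo [M].  Since [K] is
uncountable, more of these than the dimension of a space of polynomials of
bounded degree share the exponent and the size of [u a]; a linear relation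
between them makes [M] contain a nonzero polynomial in ['X_j], which splits
into linear factors. *)
Lemma maximal_ideal_contains_linear (j : 'I_n) : exists b, M ('X_j - b%:MP).
Proof.
have [M0 MD MM] := Mid.
have Msum (I : Type) (r : seq I) (P : pred I) F :
    (forall i, P i -> M (F i)) -> M (\sum_(i <- r | P i) F i).
  by move=> MF; elim/big_ind: _.
apply: contrapT => no.
have /choice[N /choice[u uP]] : forall a, exists N u, M (u * ('X_j - a%:MP) - g ^+ N).
  by move=> a; apply: Mmax => Ma; apply: no; exists a.
have [y /infinite_set_fset fy] := K_uncountable (fun a => CodeSeq.code [:: N a; msize (u a)]).
have [[a0 yE0]|Na0] := EM (exists a, CodeSeq.code [:: N a; msize (u a)] = y); last first.
  have [B BA] := fy 1%N; rewrite cardfs_gt0 => /fset0Pn[x xB].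
  by case: Na0; exists x; exact: BA.
have yE := yE0; set N0 := N a0 in yE; set D := msize (u a0) in yE.
(* One more value of a than there are monomials of degree less than D. *)
have [B BA Bcard] := fy #|{: 'X_{1..n < D}}|.+1.
pose a (i : B) := val i.
have aN i : N (a i) = N0 /\ msize (u (a i)) = D.
  have : CodeSeq.code [:: N (a i); msize (u (a i))] = CodeSeq.code [:: N0; D].
    by rewrite yE; apply: BA; exact: valP.
  by move=> /(can_inj CodeSeq.codeK) [].
have a_inj : injective a by exact: val_inj.
have [|c [i0 ci0] cu] := @linear_dependence K B 'X_{1..n < D} (fun i m => (u (a i))@_m).
  by rewrite -cardfE.
pose ev q := (map_poly (@mpolyC n K) q).['X_j].
pose q := \sum_i c i *: \prod_(k | k != i) ('X - (a k)%:P).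
have evE (r : pred B) : ev (\prod_(k | r k) ('X - (a k)%:P)) = \prod_(k | r k) ('X_j - (a k)%:MP).
  rewrite /ev rmorph_prod horner_prod; apply: eq_bigr => k _.
  by rewrite rmorphB /= map_polyX map_polyC /= hornerXsubC.
have cu0 : \sum_i c i *: u (a i) = 0.
  apply/mpolyP => m; rewrite mcoeff0 raddf_sum /=.
  have [mD|mD] := ltnP (mdeg m) D.
    by rewrite -[RHS](cu (BMultinom mD)); apply: eq_bigr => i _; rewrite mcoeffZ.
  apply: big1 => i _; rewrite mcoeffZ memN_msupp_eq0 ?mulr0 //.
  by apply: msize_mdeg_ge; have [_ ->] := aN i.
have q0 : q != 0.
  apply/eqP => /(congr1 (fun q => q.[a i0])); rewrite horner0 /q horner_sum.
  rewrite (bigD1 i0) //= [X in _ + X]big1 ?addr0 => [|i ii0].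
    rewrite hornerZ horner_prod => /eqP; rewrite mulf_eq0 (negPf ci0) /=.
    move=> /prodf_eq0[k ki0]; rewrite hornerXsubC subr_eq0 => /eqP /a_inj e.
    by rewrite e eqxx in ki0.
  by rewrite hornerZ horner_prod (bigD1 i0) ?(eq_sym i0) //= hornerXsubC subrr mul0r mulr0.
(* Modulo M the c i-combination of the products over k != i, times g ^+ N0, is
   the product over all k times the combination of the u (a i), which is 0. *)
have Mq : M (g ^+ N0 * ev q).
  have -> : g ^+ N0 * ev q = \sum_i (- c i *: \prod_(k | k != i) ('X_j - (a k)%:MP)) *
      (u (a i) * ('X_j - (a i)%:MP) - g ^+ N0).
    rewrite /ev /q rmorph_sum horner_sum /= mulr_sumr.
    transitivity (\sum_i c i *: \prod_(k | k != i) ('X_j - (a k)%:MP) * g ^+ N0).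
      apply: eq_bigr => i _; rewrite map_polyZ hornerZ /= -/(ev _) evE.
      by rewrite mul_mpolyC mulrC.
    have z : - \sum_i (\prod_k ('X_j - (a k)%:MP)) * (c i *: u (a i)) = 0.
      by rewrite -mulr_sumr cu0 mulr0 oppr0.
    rewrite -[LHS]add0r -[X in X + _]z -sumrN -big_split /=; apply: eq_bigr => i _.
    rewrite mulrBr scaleNr !mulNr opprK; congr (- _ + _).
    rewrite (bigD1 i) //= -!scalerAl -!scalerAr; congr (_ *: _).
    by rewrite -mulrA mulrC -mulrA.
  by apply: Msum => i _; apply: MM; have [<- _] := aN i; exact: uP.
have {}Mq : M (ev q).
  have [MgN|//] := maximal_ideal_prime Mq; by case: (Mg (N := N0)).
have [r qr] := closed_field_poly_normal q.
have [z Mz] : exists z, M ('X_j - z%:MP); last by apply: no; exists z.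
apply: (@maximal_ideal_contains_factor _ r).
have -> : \prod_(i <- r) ('X_j - i%:MP) = (lead_coef q)^-1%:MP * ev q.
  rewrite {2}qr /ev map_polyZ hornerZ mulrA -mpolyCM mulVf ?lead_coef_eq0 // mul1r.
  rewrite rmorph_prod horner_prod; apply: eq_bigr => k _.
  by rewrite rmorphB /= map_polyX map_polyC /= hornerXsubC.
exact: MM.
Qed.

End Nullstellensatz.

(** An ideal that contains no power of [g] has a zero at which [g] is nonzero.
The uncountability of [K] is expressed as an infinite pigeonhole principle. *)
Theorem nullstellensatz (K : closedFieldType) (n : nat) (J : set {mpoly K[n]}) g :
  (forall h : K -> nat, exists y, infinite_set (h @^-1` [set y])) ->
  is_ideal J -> (forall N, ~ J (g ^+ N)) ->
  exists2 b, forall f, J f -> f.@[b] = 0 & g.@[b] != 0.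
Proof.
move=> Kunc Jid Jg; have [M [JM Mid Mg Mmax]] := maximal_ideal_avoiding_powers Jid Jg.
have /choice[b bM] := maximal_ideal_contains_linear Kunc Mid Mg Mmax.
have [M0 MD MM] := Mid.
have Mmul (f f' h h' : {mpoly K[n]}) : M (f - f') -> M (h - h') -> M (f * h - f' * h').
  move=> Mf Mh; have -> : f * h - f' * h' = h * (f - f') + f' * (h - h').
    by rewrite !mulrBr addrA [h * f]mulrC [h * f']mulrC subrK.
  by apply: (MD); exact: MM.
(* Modulo M every polynomial is congruent to its value at b. *)
have Mb f : M (f - f.@[b]%:MP).
  elim/mpolyind: f => [|c m p _ _ IH]; first by rewrite meval0 subr0.
  rewrite mevalD mpolyCD opprD addrACA; apply: (MD) => //.
  rewrite mevalZ mpolyCM -!mul_mpolyC -mulrBr; apply: MM.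
  rewrite mevalX mpolyXE_id rmorph_prod /=.
  elim/big_rec2: _ => [|i x y _ IHi]; first by rewrite subrr.
  apply: (Mmul) => //; rewrite rmorphXn /=.
  elim: (m i) => [|e IHe]; first by rewrite !expr0 subrr.
  by rewrite !exprS; apply: (Mmul).
have Mconst c : M c%:MP -> c = 0.
  move=> Mc; apply/eqP; apply: contrapT => /negP c0; case: (Mg 0%N).
  by rewrite expr0 -mpolyC1 -(mulVf c0) mpolyCM; exact: MM.
exists b => [f /JM Mf|].
  apply: Mconst; have -> : f.@[b]%:MP = f + (-1) * (f - f.@[b]%:MP).
    by rewrite mulN1r opprB addrC subrK.
  by apply: (MD) => //; exact: MM.
apply/eqP => gb; case: (Mg 1%N).
by have := Mb g; rewrite gb mpolyC0 subr0 expr1.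
Qed.

(** A nondegenerate real interval has a nondegenerate closed subinterval that
misses a given finite set: for each point in turn, keep an outer third of the
interval, on the other side of the midpoint than the real part of the point. *)
Lemma subinterval_avoiding (R : realType) (s : seq R[i]) (a b : R) : a < b ->
  exists I : R * R, [/\ a <= I.1, I.1 < I.2, I.2 <= b &
    forall x : R, I.1 <= x <= I.2 -> x%:C%C \notin s].
Proof.
move=> ab; elim: s => [|z s [[a' b'] /= [aa' ab' bb' IH]]]; first by exists (a, b).
have [zm|zm] := leP (complex.Re z) ((a' + b') / 2).
  exists ((a' + 2 * b') / 3, b'); split=> /=; [lra|lra|by []|move=> x /andP[ax xb]].
  rewrite inE negb_or IH ?andbT; last by apply/andP; split; lra.
  by apply/eqP => xz; move: zm; rewrite -xz /=; lra.
exists (a', (2 * a' + b') / 3); split=> /=; [by []|lra|lra|move=> x /andP[ax xb]].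
rewrite inE negb_or IH ?andbT; last by apply/andP; split; lra.
by apply/eqP => xz; move: zm; rewrite -xz /=; lra.
Qed.

(** Otherwise nested intervals avoiding the finite fibres of [h] one after the
other would have a common point, at which [h] has no possible value. *)
Lemma complex_uncountable (R : realType) (h : R[i] -> nat) :
  exists y, infinite_set (h @^-1` [set y]).
Proof.
apply: contrapT => no.
have /choice[s sP] : forall y, exists s : seq R[i], h @^-1` [set y] = [set` s].
  by move=> y; apply/finite_seqP; apply: contrapT => inf; apply: no; exists y.
have /choice[next nextP] : forall yI : nat * (R * R), exists I : R * R, yI.2.1 < yI.2.2 ->
    [/\ yI.2.1 <= I.1, I.1 < I.2, I.2 <= yI.2.2 &
    forall x : R, I.1 <= x <= I.2 -> x%:C%C \notin s yI.1].
  move=> [y [a b]] /=; have [ab|ab] := ltP a b; last by exists (a, b).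
  by have [I IP] := subinterval_avoiding (s y) ab; exists I.
pose I := fix I n := if n is m.+1 then next (m, I m) else (0 : R, 1 : R).
have Ilt n : (I n).1 < (I n).2.
  by elim: n => [|n IH] /=; [exact: ltr01 | have [] := nextP (n, I n) IH].
have IS n : (I n).1 <= (I n.+1).1 /\ (I n.+1).2 <= (I n).2.
  by have [] := nextP (n, I n) (Ilt n).
have Ile m n : (m <= n)%N -> (I m).1 <= (I n).1 /\ (I n).2 <= (I m).2.
  move=> mn; rewrite -(subnKC mn); elim: (n - m)%N => [|k [IH1 IH2]]; first by rewrite addn0.
  by rewrite addnS; have [l u] := IS (m + k)%N; split; [exact: le_trans l | exact: le_trans IH2].
have Icross m n : (I m).1 <= (I n).2.
  have [mn|/ltnW nm] := leqP m n.
    by apply: le_trans (ltW (Ilt n)); have [] := Ile _ _ mn.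
  by apply: le_trans (ltW (Ilt m)) _; have [] := Ile _ _ nm.
pose E := [set (I n).1 | n in [set: nat]].
have ubE n : ubound E (I n).2 by move=> _ [m _ <-].
pose x := reals.sup E.
have [_ _ _ /(_ x)] := nextP (h x%:C%C, I (h x%:C%C)) (Ilt _).
suff -> : (next (h x%:C%C, I (h x%:C%C))).1 <= x <= (next (h x%:C%C, I (h x%:C%C))).2.
  move=> /(_ isT) /= /negP; apply.
  have : (h @^-1` [set h x%:C%C]) x%:C%C by [].
  by rewrite sP.
have -> : next (h x%:C%C, I (h x%:C%C)) = I (h x%:C%C).+1 by [].
apply/andP; split; last by apply: ge_sup => //; exists (I 0%N).1; exists 0%N.
by apply: ub_le_sup; [exists (I 0%N).2 | exists (h x%:C%C).+1].
Qed.

(** * Hilbert functions and lengths of chains *)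

Section Growth.
Variable K : fieldType.
Implicit Types (n d : nat).

(** The restrictions to [M] of the forms of degree [d] span a space of dimension
at most [#|S|]: the evaluations of monomials at [v] factor through the vectors
[phi m], which do not depend on [v].  This form is multiplicative for
coordinatewise products, see [hilbert_le_mul]. *)
Definition hilbert_le n (M : set ('I_n -> K)) (d : nat) (S : finType) :=
  exists phi : 'X_{1..n} -> S -> K, forall v, M v -> exists psi : S -> K,
    forall m, mdeg m = d -> 'X_[m].@[v] = \sum_s phi m s * psi s.

(** The Hilbert function of [M] is at most a constant times [d.+1 ^ r]. *)
Definition spanned_growth n (M : set ('I_n -> K)) (r : nat) :=
  exists C : nat, forall d, exists S : finType,
    (#|S| <= C * d.+1 ^ r)%N /\ hilbert_le M d S.

(** The same bound, stated as the existence of linear relations on [M] between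
sufficiently many forms of degree [d].  This form involves only the forms that
vanish on [M], so it passes to Zariski closures. *)
Definition growth n (M : set ('I_n -> K)) (r : nat) :=
  exists C : nat, forall d (I : finType) (f : I -> {mpoly K[n]}),
    (forall i, f i \is d.-homog) -> (C * d.+1 ^ r < #|I|)%N ->
    exists2 c : I -> K, exists i, c i != 0 & vanishes M (\sum_i c i *: f i).

Lemma meval_dhomog n (f : {mpoly K[n]}) d (S : finType) (phi : 'X_{1..n} -> S -> K) psi v :
  f \is d.-homog ->
  (forall m, mdeg m = d -> 'X_[m].@[v] = \sum_s phi m s * psi s) ->
  f.@[v] = \sum_s (\sum_(m <- msupp f) f@_m * phi m s) * psi s.
Proof.
move=> /dhomogP fd vE; rewrite [in LHS](mpolyE f) raddf_sum /=.
under [RHS]eq_bigr do rewrite mulr_suml.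
rewrite exchange_big /= big_seq [RHS]big_seq; apply: eq_bigr => m mf.
by rewrite mevalZ vE ?fd // mulr_sumr; apply: eq_bigr => s _; rewrite mulrA.
Qed.

Lemma hilbert_le_dependence n (M : set ('I_n -> K)) d (S I : finType)
    (f : I -> {mpoly K[n]}) :
  hilbert_le M d S -> (forall i, f i \is d.-homog) -> (#|S| < #|I|)%N ->
  exists2 c : I -> K, exists i, c i != 0 & vanishes M (\sum_i c i *: f i).
Proof.
move=> [phi phiP] fd SI.
have [c c0 cP] := linear_dependence (fun i s => \sum_(m <- msupp (f i)) (f i)@_m * phi m s) SI.
exists c => // v Mv; have [psi psiP] := phiP v Mv.
rewrite raddf_sum /=.
under eq_bigr => i _ do rewrite mevalZ (meval_dhomog (fd i) psiP) mulr_sumr.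
rewrite exchange_big /= big1 // => s _.
under eq_bigr do rewrite mulrA.
by rewrite -mulr_suml cP mul0r.
Qed.

Lemma growth_subset n (M N : set ('I_n -> K)) r : M `<=` N -> growth N r -> growth M r.
Proof.
move=> MN [C CP]; exists C => d I f fd CI; have [c c0 cN] := CP d I f fd CI.
by exists c => // v /MN; exact: cN.
Qed.

Lemma spanned_growthW n (M : set ('I_n -> K)) r : spanned_growth M r -> growth M r.
Proof.
move=> [C CP]; exists C => d I f fd CI; have [S [SC MS]] := CP d.
exact: (hilbert_le_dependence MS fd (leq_ltn_trans SC CI)).
Qed.

(** The set of coordinatewise products of a vector of [M] and one of [N]. *)
Definition hmul n (M N : set ('I_n -> K)) : set ('I_n -> K) :=
  [set (fun i => v i * w i) | v in M & w in N].

(** The set of coordinatewise products of [k] vectors of [M]; for [k = 0] it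
consists of the vector of ones. *)
Fixpoint hpow n (M : set ('I_n -> K)) (k : nat) : set ('I_n -> K) :=
  if k is k'.+1 then hmul M (hpow M k') else [set fun=> 1].

Lemma mevalX_mul n (m : 'X_{1..n}) (v w : 'I_n -> K) :
  'X_[m].@[fun i => v i * w i] = 'X_[m].@[v] * 'X_[m].@[w].
Proof. by rewrite !mevalX -big_split /=; apply: eq_bigr => i _; rewrite exprMn. Qed.

Lemma hilbert_le_mul n (M N : set ('I_n -> K)) d (S T : finType) :
  hilbert_le M d S -> hilbert_le N d T -> hilbert_le (hmul M N) d (S * T)%type.
Proof.
move=> [phi phiP] [phi' phiP']; exists (fun m st => phi m st.1 * phi' m st.2).
move=> _ [v Mv [w Nw <-]]; have [psi psiP] := phiP v Mv; have [psi' psiP'] := phiP' w Nw.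
exists (fun st => psi st.1 * psi' st.2) => m md.
rewrite mevalX_mul psiP // psiP' // big_distrlr /= pair_bigA /=.
by apply: eq_bigr => st _; rewrite mulrACA.
Qed.

Lemma hilbert_le_singleton n (u : 'I_n -> K) d : hilbert_le [set u] d unit.
Proof.
exists (fun m _ => 'X_[m].@[u]) => _ ->; exists (fun=> 1) => m _.
by rewrite big_const card_unit /= addr0 mulr1.
Qed.

Lemma spanned_growth_pow n (M : set ('I_n -> K)) k :
  spanned_growth M 1 -> spanned_growth (hpow M k) k.
Proof.
move=> [C CP]; exists (C ^ k)%N => d; have [S [Sle MS]] := CP d.
suff [T [TS MT]] : exists T : finType, #|T| = (#|S| ^ k)%N /\ hilbert_le (hpow M k) d T.
  exists T; rewrite TS; split=> //; rewrite -expnMn.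
  by case: k {T TS MT} => [|k]; rewrite ?expn0 // leq_exp2r // -(expn1 d.+1).
elim: k => [|k [T [TS MT]]].
  by exists unit; rewrite card_unit; split=> //; exact: hilbert_le_singleton.
exists (S * T)%type; rewrite card_prod TS expnS; split=> //.
exact: hilbert_le_mul.
Qed.

(** A monomial of degree [d] is determined by its first [n] exponents. *)
Lemma spanned_growth_setT n : spanned_growth [set: 'I_n.+1 -> K] n.
Proof.
exists 1%N => d; exists {ffun 'I_n -> 'I_d.+1}.
rewrite card_ffun !card_ord mul1n; split=> //.
pose proj (m : 'X_{1..n.+1}) : {ffun 'I_n -> 'I_d.+1} :=
  [ffun i => inord (m (widen_ord (leqnSn n) i))].
exists (fun m s => (s == proj m)%:R) => v _.
exists (fun s : {ffun 'I_n -> 'I_d.+1} => (\prod_(i < n) v (widen_ord (leqnSn n) i) ^+ s i) *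
  v ord_max ^+ (d - \sum_(i < n) s i)) => m md.
rewrite (bigD1 (proj m)) //= eqxx mul1r [X in _ + X]big1 ?addr0 => [|s /negPf->];
  last by rewrite mul0r.
have mle i : (m i <= d)%N by rewrite -md mdegE (bigD1 i) //= leq_addr.
have projE i : proj m i = m (widen_ord (leqnSn n) i) :> nat by rewrite ffunE inordK // ltnS.
rewrite mevalX big_ord_recr /=; congr (_ * _ ^+ _).
  by apply: eq_bigr => i _; rewrite projE.
under [in RHS]eq_bigr do rewrite projE.
by rewrite -md mdegE big_ord_recr /= addKn.
Qed.

(** The homogeneous ideal of [M] is prime, the unit ideal being allowed. *)
Definition prime_set n (M : set ('I_n -> K)) :=
  forall d e (f g : {mpoly K[n]}), f \is d.-homog -> g \is e.-homog ->
    vanishes M (f * g) -> vanishes M f \/ vanishes M g.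

Section Chain.
Variables (n : nat) (M : nat -> set ('I_n -> K)) (F : nat -> {mpoly K[n]}) (delta : nat).

(** The monomial with exponents [a 0], ..., [a e.-1] in [F 0], ..., [F e.-1]. *)
Definition power_product (e : nat) (a : nat -> nat) : {mpoly K[n]} :=
  \prod_(l < e) F l ^+ a l.

Hypothesis Fhom : forall l, F l \is delta.-homog.

Lemma power_product_homog e a :
  power_product e a \is (delta * \sum_(l < e) a l)%N.-homog.
Proof.
elim: e => [|e IH]; rewrite /power_product.
  by rewrite !big_ord0 muln0; exact: dhomog1.
rewrite !big_ord_recr /= mulnDr; apply: dhomogM => //.
exact: dhomogMn.
Qed.

(** Distinct monomials of one degree in [F 0], ..., [F e] are linearly independent
on [M e].  The exponents of [F 0] need not be distinguished, as the degree
determines them. *)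
Lemma power_products_independent e (I : finType) (P : pred I) (a : I -> nat -> nat)
    (c : I -> K) (s : nat) :
  (forall i, (i <= e)%N -> prime_set (M i)) ->
  (forall i, (i < e)%N -> M i `<=` M i.+1) ->
  (forall i, (i < e)%N -> vanishes (M i) (F i.+1)) ->
  (forall i, (i <= e)%N -> ~ vanishes (M i) (F i)) ->
  (forall i, P i -> c i != 0) ->
  (forall i j, P i -> P j -> (forall l, (l < e)%N -> a i l.+1 = a j l.+1) -> i = j) ->
  (forall i, P i -> \sum_(l < e.+1) a i l = s) ->
  vanishes (M e) (\sum_(i | P i) c i *: power_product e.+1 (a i)) -> P =1 pred0.
Proof.
move=> Mp Ms Fv Fnv; elim: e => [|e IH] in P a s Mp Ms Fv Fnv *.
  move=> c0 inj _ van i; apply/negP => Pi.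
  apply: (Fnv 0%N) => // v Mv; have := van v Mv.
  rewrite (bigD1 i) //= big1 ?addr0; last first.
    by move=> j /andP[Pj]; rewrite (inj j i) ?eqxx.
  rewrite mevalZ /power_product big_ord1 rmorphXn /= => /eqP.
  rewrite mulf_eq0 (negPf (c0 _ Pi)) /= expf_eq0 => /andP[_ /eqP //].
move=> c0 inj sums van i0; apply/negP => Pi0.
case: (arg_minnP (fun i => a i e.+1) Pi0) => i1 Pi1 amin.
set m := a i1 e.+1 in amin.
pose G := \sum_(i | P i) c i *: (power_product e.+1 (a i) * F e.+1 ^+ (a i e.+1 - m)).
have homG : G \is (delta * (s - m))%N.-homog.
  apply: rpred_sum => i Pi; apply: dhomogZ.
  have -> : (delta * (s - m) = delta * (\sum_(l < e.+1) a i l) + delta * (a i e.+1 - m))%N.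
    rewrite -(sums i Pi) big_ord_recr /= -mulnDr addnBA //; exact: amin.
  by apply: dhomogM; [exact: power_product_homog | exact: dhomogMn].
(* Divide by the largest common power of F e.+1, then restrict to M e, where
   only the terms with the least exponent of F e.+1 survive. *)
have vanG : vanishes (M e.+1) G.
  have vanFG : vanishes (M e.+1) (F e.+1 ^+ m * G).
    move=> v Mv; rewrite -[RHS](van v Mv); congr (_.@[v]); rewrite mulr_sumr.
    apply: eq_bigr => i Pi; rewrite -scalerAr [in RHS]/power_product big_ord_recr /=.
    by rewrite mulrCA -exprD subnKC //; exact: amin.
  have [vanF|//] := Mp e.+1 (leqnn _) _ _ _ _ (dhomogMn m (Fhom _)) homG vanFG.
  case: (Fnv e.+1 (leqnn _)) => v Mv; have /eqP := vanF v Mv.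
  by rewrite rmorphXn /= expf_eq0 => /andP[_ /eqP].
pose Q i := P i && (a i e.+1 == m).
have /(_ i1) : Q =1 pred0; last by rewrite /Q Pi1 /= eqxx.
apply: (IH Q a (s - m)%N).
- by move=> i /leqW; exact: Mp.
- by move=> i /leqW; exact: Ms.
- by move=> i /leqW; exact: Fv.
- by move=> i /leqW; exact: Fnv.
- by move=> i /andP[/c0].
- move=> i j /andP[Pi /eqP ai] /andP[Pj /eqP aj] eqa; apply: inj => // l.
  by rewrite ltnS leq_eqVlt => /predU1P[->|]; [rewrite ai aj | exact: eqa].
- by move=> i /andP[Pi /eqP ai]; rewrite -(sums i Pi) [in RHS]big_ord_recr /= ai addnK.
move=> v Mv; rewrite -[RHS](vanG v (Ms e (ltnSn _) v Mv)) /G !raddf_sum /=.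
rewrite [RHS](bigID (fun i => a i e.+1 == m)) /= [X in _ + X]big1 ?addr0.
  by apply: eq_bigr => i /andP[Pi /eqP ai]; rewrite ai subnn expr0 mulr1.
move=> i /andP[Pi aim]; rewrite mevalZ mevalM rmorphXn /= (Fv e) // expr0n.
have : (m < a i e.+1)%N by rewrite ltn_neqAle eq_sym aim amin.
by rewrite -subn_gt0 lt0n => /negPf->; rewrite !mulr0.
Qed.

End Chain.

(** If [t ^ s] grows at most like [t ^ r], then [s <= r]. *)
Lemma leq_exponent (a b r s : nat) :
  (forall t, t.+1 ^ s <= a * (b * t).+1 ^ r)%N -> (s <= r)%N.
Proof.
move=> le; have [//|rs] := leqP s r; have := le (a * b.+1 ^ r)%N.
set t := (a * b.+1 ^ r)%N; rewrite leqNgt => /negP[].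
apply: (@leq_trans (t.+1 ^ r.+1)); last by rewrite leq_pexp2l.
apply: (@leq_ltn_trans (t * t.+1 ^ r)); last by rewrite expnS ltn_mul2r expn_gt0 /= ltnSn.
rewrite {2}/t -mulnA leq_mul2l -expnMn; apply/orP; right.
have : ((b * t).+1 <= b.+1 * t.+1)%N by nia.
by case: (r) => [|r'] h; rewrite ?expn0 // leq_exp2r.
Qed.

(** A strictly increasing chain of sets with prime ideals is no longer than the
order of growth of the Hilbert function of its last member. *)
Theorem chain_length_le_growth n (M : nat -> set ('I_n -> K)) (e r : nat) :
  (forall i, (i <= e)%N -> prime_set (M i)) ->
  (forall i, (i <= e)%N -> exists2 v, M i v & exists j, v j != 0) ->
  (forall i, (i < e)%N -> M i `<=` M i.+1) ->
  (forall i, (i < e)%N -> exists2 f, exists d, f \is d.-homog &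
    vanishes (M i) f /\ ~ vanishes (M i.+1) f) ->
  growth (M e) r -> (e <= r)%N.
Proof.
move=> Mp Mnz Ms Msep [C Cgrow].
have /choice[G /choice[d GP]] : forall i, exists (f : {mpoly K[n]}) d, f \is d.-homog /\
    ((i < e)%N -> vanishes (M i) f /\ ~ vanishes (M i.+1) f).
  move=> i; have [ie|] := boolP (i < e)%N; last by exists 0, 0%N; rewrite rpred0.
  by have [f [d' fd] [fv fnv]] := Msep i ie; exists f, d'.
pose delta := (\sum_(i < e) d i)%N.
have xpow i k : (i <= e)%N -> exists j : 'I_n, ~ vanishes (M i) ('X_j ^+ k).
  move=> ie; have [v Mv [j vj]] := Mnz i ie; exists j => /(_ v Mv) /eqP.
  by rewrite rmorphXn /= mevalXU expf_eq0 (negPf vj) andbF.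
have Xhom (j : 'I_n) k : 'X_j ^+ k \is [in K[n], k.-homog].
  by rewrite -[X in X.-homog]mul1n; apply: dhomogMn; rewrite dhomogX /= mdeg1.
(* Multiplying by a power of a variable brings all the forms to degree delta. *)
have /choice[F FP] : forall i, exists f : {mpoly K[n]}, f \is delta.-homog /\
    ((i <= e)%N -> ~ vanishes (M i) f /\ if i is l.+1 then vanishes (M l) f else True).
  move=> [|i].
    have [j jP] := xpow 0%N delta (leq0n _); by exists ('X_j ^+ delta).
  have [ie|ie] := boolP (i < e)%N; last by exists 0; rewrite rpred0.
  have [j jP] := xpow i.+1 (delta - d i)%N ie.
  have [Gd /(_ ie)[Gv Gnv]] := GP i.
  have dle : (d i <= delta)%N by rewrite /delta (bigD1 (Ordinal ie)) //= leq_addr.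
  exists (G i * 'X_j ^+ (delta - d i)); split.
    by rewrite -{2}(subnKC dle); exact: dhomogM.
  move=> _; split; last by move=> v Mv; rewrite mevalM Gv // mul0r.
  by move=> /(Mp i.+1 ie _ _ _ _ Gd (Xhom j _))[].
have Fhom l : F l \is delta.-homog by have [] := FP l.
apply: (@leq_exponent C (delta * e)) => s; rewrite leqNgt -mulnA; apply/negP => CI.
pose I := {ffun 'I_e -> 'I_s.+1}.
(* All exponents but that of F 0 are free, up to s; the total degree is e * s. *)
pose a (i : I) l :=
  if l is l'.+1 then oapp (fun x => i x : nat) 0%N (insub l') else (e * s - \sum_(l < e) i l)%N.
have aS i (l : 'I_e) : a i l.+1 = i l by rewrite /a valK.
have sums i : (\sum_(l < e.+1) a i l = e * s)%N.
  rewrite big_ord_recl (eq_bigr (fun l => i l : nat)) => [|l _]; last exact: aS.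
  rewrite subnK //; apply: (@leq_trans (\sum_(l < e) s)).
    by apply: leq_sum => l _; rewrite -ltnS ltn_ord.
  by rewrite sum_nat_const card_ord.
have [||c [i0 ci0] cv] := Cgrow (delta * (e * s))%N I (fun i => power_product F e.+1 (a i)).
- by move=> i; rewrite -(sums i); exact: power_product_homog.
- by rewrite card_ffun !card_ord.
suff /(_ i0) : (fun i => c i != 0) =1 pred0 by rewrite /= ci0.
apply: (power_products_independent (F := F) (a := a) (c := c) Fhom Mp Ms) => //.
- by move=> i ie; have [_ /(_ ie)[]] := FP i.+1.
- by move=> i ie; have [_ /(_ ie)[]] := FP i.
- by move=> i j _ _ eqa; apply/ffunP => l; apply/val_inj; rewrite /= -!aS; exact: eqa.
move=> v Mv; rewrite -[RHS](cv v Mv); congr (_.@[v]).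
rewrite [RHS](bigID (fun i => c i != 0)) /= [X in _ + X]big1 ?addr0 // => i.
by rewrite negbK => /eqP->; rewrite scale0r.
Qed.

(** On a set on which no nonzero form vanishes, the Hilbert function is that of
the polynomial ring in [n.+1] variables. *)
Lemma no_form_growth n (M : set ('I_n.+1 -> K)) r :
  (forall d (f : {mpoly K[n.+1]}), f \is d.-homog -> vanishes M f -> f = 0) ->
  growth M r -> (n <= r)%N.
Proof.
move=> M0 [C CP]; apply: (@leq_exponent C n) => s; rewrite leqNgt; apply/negP => CI.
pose I := {ffun 'I_n -> 'I_s.+1}.
pose mon (i : I) : 'X_{1..n.+1} :=
  [multinom oapp (fun x => i x : nat) (n * s - \sum_(y < n) i y)%N (insub (x : nat)) | x < n.+1].
have monE i (x : 'I_n) : mon i (widen_ord (leqnSn n) x) = i x by rewrite mnmE /= valK.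
have mon_max i : mon i ord_max = (n * s - \sum_(y < n) i y)%N by rewrite mnmE insubF //= ltnn.
have mon_inj : injective mon.
  by move=> i j eij; apply/ffunP => x; apply/val_inj; rewrite /= -!monE eij.
have homX i : 'X_[K, mon i] \is (n * s)%N.-homog.
  rewrite dhomogX /= mdegE big_ord_recr /= mon_max.
  rewrite (eq_bigr (fun x => i x : nat)) => [|x _]; last exact: monE.
  rewrite subnKC //; apply: (@leq_trans (\sum_(l < n) s)).
    by apply: leq_sum => l _; rewrite -ltnS ltn_ord.
  by rewrite sum_nat_const card_ord.
have [|c [i0 ci0] cv] := CP (n * s)%N I _ homX; first by rewrite card_ffun !card_ord.
have homc : \sum_i c i *: 'X_[mon i] \is (n * s)%N.-homog.
  by apply: rpred_sum => i _; exact: dhomogZ.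
have /(congr1 (mcoeff (mon i0))) := M0 _ _ homc cv.
rewrite mcoeff0 raddf_sum /= (bigD1 i0) //= big1 ?addr0 => [|j ji].
  rewrite mcoeffZ mcoeffX eqxx mulr1 => c0.
  by rewrite c0 ?eqxx in ci0.
by rewrite mcoeffZ mcoeffX (inj_eq mon_inj) (negPf ji) mulr0.
Qed.

End Growth.

(** * Coordinatewise products *)

Section HadamardChain.
Variable K : fieldType.

Lemma meval_scale n (f : {mpoly K[n]}) d c v :
  f \is d.-homog -> f.@[fun i => c * v i] = c ^+ d * f.@[v].
Proof.
move=> /dhomogP fd; rewrite [f in LHS]mpolyE [f in RHS]mpolyE !raddf_sum /= mulr_sumr.
rewrite big_seq [RHS]big_seq; apply: eq_bigr => m mf.
rewrite !mevalZ mevalX_mul mulrCA; congr (_ * _); rewrite mevalX.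
by have <- : mdeg m = d := fd m mf; rewrite mdegE -prodrXr.
Qed.

(** A form that does not vanish at the origin is constant. *)
Lemma meval_dhomog0 n (f : {mpoly K[n]}) d v u :
  f \is d.-homog -> (forall i, v i = 0) -> f.@[v] != 0 -> f.@[u] = f.@[v].
Proof.
move=> fd v0; have -> : f.@[v] = 0 ^+ d * f.@[u].
  by rewrite -(meval_scale _ _ fd); apply: meval_eq => i; rewrite v0 mul0r.
rewrite expr0n; case: (d == 0%N) => /=; first by rewrite mul1r.
by rewrite mul0r eqxx.
Qed.

(** The polynomial obtained from [f] by multiplying the variables by the
coordinates of [v]. *)
Definition twist n (v : 'I_n -> K) (f : {mpoly K[n]}) : {mpoly K[n]} :=
  \sum_(m <- msupp f) (f@_m * 'X_[m].@[v]) *: 'X_[m].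

Lemma meval_twist n v (f : {mpoly K[n]}) w :
  (twist v f).@[w] = f.@[fun i => v i * w i].
Proof.
rewrite [f in RHS]mpolyE !raddf_sum /=; apply: eq_bigr => m _.
by rewrite !mevalZ mevalX_mul mulrA.
Qed.

Lemma twist_homog n v (f : {mpoly K[n]}) d : f \is d.-homog -> twist v f \is d.-homog.
Proof.
move=> /dhomogP fd; rewrite /twist big_seq; apply: rpred_sum => m mf.
by apply: dhomogZ; rewrite dhomogX /= fd.
Qed.

Lemma mcoeff_twist n v (f : {mpoly K[n]}) m : (twist v f)@_m = f@_m * 'X_[m].@[v].
Proof.
rewrite /twist raddf_sum /=.
have [mf|mf] := boolP (m \in msupp f).
  rewrite (bigD1_seq m) ?msupp_uniq //= mcoeffZ mcoeffX eqxx mulr1 big1 ?addr0 // => m' /negPf m'm.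
  by rewrite mcoeffZ mcoeffX m'm mulr0.
rewrite (memN_msupp_eq0 mf) mul0r big_seq big1 // => m' m'f.
rewrite mcoeffZ mcoeffX; case: eqP => [m'm|]; last by rewrite mulr0.
by rewrite m'm (negPf mf) in m'f.
Qed.

(** If [f] is nonzero at the product [v0 * w0] and [g] at [v1 * w1], primality of
[N] gives a common [w] for which [f] is nonzero at [v0 * w] and [g] at [v1 * w];
primality of [M] then gives a common [v]. *)
Lemma prime_set_hmul n (M N : set ('I_n -> K)) :
  prime_set M -> prime_set N -> prime_set (hmul M N).
Proof.
move=> Mp Np d e f g fd ge fg.
apply: contrapT => /not_orP[/existsNP[_ /not_implyP[[v0 Mv0 [w0 Nw0 <-]] fvw]]
  /existsNP[_ /not_implyP[[v1 Mv1 [w1 Nw1 <-]] gvw]]].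
have [w Nw [fw gw]] : exists2 w, N w &
    f.@[fun i => v0 i * w i] <> 0 /\ g.@[fun i => v1 i * w i] <> 0.
  apply: contrapT => no.
  have [w Nw||] := Np _ _ _ _ (twist_homog v0 fd) (twist_homog v1 ge).
  - rewrite mevalM !meval_twist; apply/eqP; rewrite mulf_eq0; apply/negPn/negP.
    by rewrite negb_or => /andP[/eqP fw /eqP gw]; apply: no; exists w.
  - by move=> /(_ w0 Nw0); rewrite meval_twist.
  - by move=> /(_ w1 Nw1); rewrite meval_twist.
have fC v : f.@[fun i => v i * w i] = (twist w f).@[v].
  by rewrite meval_twist; apply: meval_eq => i; rewrite mulrC.
have gC v : g.@[fun i => v i * w i] = (twist w g).@[v].
  by rewrite meval_twist; apply: meval_eq => i; rewrite mulrC.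
rewrite fC in fw; rewrite gC in gw.
have [v Mv||] := Mp _ _ _ _ (twist_homog w fd) (twist_homog w ge).
- by rewrite mevalM -fC -gC -mevalM; apply: fg; exists v => //; exists w.
- by move=> /(_ v0 Mv0).
- by move=> /(_ v1 Mv1).
Qed.

Lemma prime_set1 n (u : 'I_n -> K) : prime_set [set u].
Proof.
move=> d e f g _ _ /(_ u erefl) /eqP; rewrite mevalM mulf_eq0.
by move=> /orP[] /eqP fu; [left|right] => _ ->.
Qed.

Lemma prime_set_hpow n (M : set ('I_n -> K)) k : prime_set M -> prime_set (hpow M k).
Proof.
by move=> Mp; elim: k => [|k IH]; [exact: prime_set1 | exact: prime_set_hmul].
Qed.

(** Dedekind's independence of characters, for monomials as characters on [M]: a
space of forms stable under the twists by the elements of [M] contains, with a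
nonzero form, a monomial, if the monomials are distinct on [M].  Here the space
is that of the forms vanishing on [N], which contains no monomial because [N]
has the point [u]. *)
Lemma dedekind_independence n (M N : set ('I_n -> K)) d (u : 'I_n -> K) :
  N u -> (forall i, u i != 0) ->
  (forall f, f \is d.-homog -> vanishes N f -> vanishes (hmul M N) f) ->
  (forall m m', mdeg m = d -> mdeg m' = d -> m != m' ->
    exists2 v, M v & 'X_[m].@[v] != 'X_[m'].@[v]) ->
  forall f, f \is d.-homog -> vanishes N f -> f = 0.
Proof.
move=> Nu u0 NM chars f; have [N0 sz] := ubnP (size (msupp f)).
elim: N0 f sz => // N0 IH f sz fd fv; have /dhomogP fdm := fd.
have uX m : 'X_[m].@[u] != 0 by rewrite mevalX; apply/prodf_neq0 => i _; rewrite expf_neq0.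
case def_s: (msupp f) => [|m [|m' s]]; first exact: msuppnil0.
  have := fv u Nu; rewrite [f in f.@[_]]mpolyE def_s big_seq1 mevalZ => /eqP.
  by rewrite mulf_eq0 (negPf (uX m)) orbF mcoeff_eq0 def_s inE eqxx.
have mf : m \in msupp f by rewrite def_s inE eqxx.
have m'f : m' \in msupp f by rewrite def_s !inE eqxx orbT.
have mm' : m != m'.
  by have := msupp_uniq f; rewrite def_s /= inE negb_or => /andP[/andP[]].
have [v Mv vmm'] := chars m m' (fdm _ mf) (fdm _ m'f) mm'.
(* g has fewer monomials than f: it has lost m, but it keeps m'. *)
pose g := twist v f - 'X_[m].@[v] *: f.
have gE x : g@_x = f@_x * ('X_[x].@[v] - 'X_[m].@[v]).
  by rewrite mcoeffB mcoeff_twist mcoeffZ mulrBr [_ * f@_x]mulrC.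
have g0 : g = 0.
  apply: IH.
  - have : {subset msupp g <= rem m (msupp f)}.
      move=> x; rewrite mcoeff_msupp gE mulf_eq0 negb_or -mcoeff_msupp => /andP[xf xm].
      rewrite mem_rem_uniq ?msupp_uniq // !inE xf andbT.
      by apply: contraNneq xm => ->; rewrite subrr.
    move=> /(uniq_leq_size (msupp_uniq g)) /leq_ltn_trans; apply.
    by rewrite size_rem // -ltnS prednK // def_s.
  - by apply: rpredB; [exact: twist_homog | exact: rpredZ].
  - move=> w Nw; rewrite mevalB mevalZ fv // mulr0 subr0 meval_twist.
    by apply: NM => //; exists v => //; exists w.
have := gE m'; rewrite g0 mcoeff0 => /esym/eqP; rewrite mulf_eq0 mcoeff_eq0 m'f /=.
by rewrite subr_eq0 eq_sym (negPf vmm').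
Qed.

(** The translates [p^(k - j) * A^j], for [j] from 0 to [k], increase with [j].
They are strictly increasing, in the sense that some form separates two
successive ones, until no nonzero form vanishes on them; comparing Hilbert
functions, this happens for [j = n] if [n <= k] and not before.  The hypothesis
on binomials makes the monomials of one degree distinct on [p^-1 * A]. *)
Lemma hadamard_power_chain n (A : set ('I_n.+1 -> K)) p k (e := minn n k) :
  prime_set A -> A p -> (forall i, p i != 0) -> spanned_growth A 1 ->
  (forall (m m' : 'X_{1..n.+1}) a b, a != 0 -> b != 0 -> m != m' -> mdeg m = mdeg m' ->
    ~ vanishes A (a *: 'X_[m] + b *: 'X_[m'])) ->
  exists N : nat -> set ('I_n.+1 -> K),
    [/\ forall i, (i <= e)%N -> prime_set (N i),
        forall i, (i <= e)%N -> exists2 v, N i v & forall j, v j != 0,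
        forall i, (i < e)%N -> N i `<=` N i.+1,
        forall i, (i < e)%N -> exists2 f, exists d, f \is d.-homog &
          vanishes (N i) f /\ ~ vanishes (N i.+1) f &
        N e `<=` hpow A k].
Proof.
move=> Ap pA p0 Agrow binom.
pose q i := (p i)^-1; pose M := hmul [set q] A.
have q0 i : q i != 0 by rewrite invr_eq0.
have M1 : M (fun=> 1).
  by exists q => //; exists p => //; apply/funext => i; rewrite mulVf.
have Mp : prime_set M by apply: prime_set_hmul => //; exact: prime_set1.
have Mgrow : spanned_growth M 1.
  have [C CP] := Agrow; exists C => d; have [S [SC AS]] := CP d.
  exists (unit * S)%type; rewrite card_prod card_unit mul1n; split=> //.
  by apply: hilbert_le_mul => //; exact: hilbert_le_singleton.
have pow1 j : hpow M j (fun=> 1).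
  elim: j => [//|j IH]; exists (fun=> 1) => //; exists (fun=> 1) => //.
  by apply/funext => i; rewrite mulr1.
have powS j : hpow M j `<=` hpow M j.+1.
  move=> v Mv; exists (fun=> 1) => //; exists v => //.
  by apply/funext => i; rewrite mul1r.
have chars (m m' : 'X_{1..n.+1}) : m != m' -> mdeg m = mdeg m' ->
    exists2 v, M v & 'X_[m].@[v] != 'X_[m'].@[v].
  move=> mm' dmm'; apply: contrapT => no.
  have qX (x : 'X_{1..n.+1}) : 'X_[x].@[q] != 0.
    by rewrite mevalX; apply/prodf_neq0 => i _; rewrite expf_neq0.
  apply: (binom m m' 'X_[m].@[q] (- 'X_[m'].@[q])) => //; first by rewrite oppr_eq0.
  move=> v Av; rewrite mevalD !mevalZ mulNr -!mevalX_mul; apply/eqP; rewrite subr_eq0.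
  apply/negPn/negP => ne; apply: no.
  by exists (fun i => q i * v i) => //; exists q => //; exists v.
(* No nonzero form vanishes on the j-th power. *)
pose full j := forall d (f : {mpoly K[n.+1]}), f \is d.-homog -> vanishes (hpow M j) f -> f = 0.
have sep j : ~ full j -> exists2 f, exists d, f \is d.-homog &
    vanishes (hpow M j) f /\ ~ vanishes (hpow M j.+1) f.
  move=> nfull; apply: contrapT => no; apply: nfull => d f fd fv.
  apply: (dedekind_independence (M := M) (u := fun=> 1)) fd fv => //.
  - by move=> i; exact: oner_neq0.
  - by move=> g gd gv; apply: contrapT => gnv; apply: no; exists g; [exists d|].
  - by move=> m m' md md' mm'; apply: chars => //; rewrite md md'.
have [e' [e'k e'min e'max]] : exists e', [/\ (e' <= k)%N,
    forall j, (j < e')%N -> ~ full j & e' = k \/ full e'].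
  elim: (k) => [|k' [e' [e'k e'min [e'E|e'full]]]]; first by exists 0%N; split=> //; left.
  - have [fk|nfk] := EM (full e').
      by exists e'; split=> //; [exact: leqW | right].
    exists e'.+1; split; rewrite ?e'E //; last by left.
    by move=> j; rewrite ltnS leq_eqVlt -e'E => /predU1P[->//|]; exact: e'min.
  - by exists e'; split=> //; [exact: leqW | right].
(* With M = p^-1 * A, the set N j is p^k * M^j = p^(k - j) * A^j. *)
pose pk i := p i ^+ k; pose N j := hmul [set pk] (hpow M j).
have Np j : prime_set (N j).
  by apply: prime_set_hmul; [exact: prime_set1 | exact: prime_set_hpow].
have pk0 i : pk i != 0 by rewrite expf_neq0.
have Nnz j : exists2 v, N j v & forall i, v i != 0.
  exists pk => //; exists pk => //; exists (fun=> 1) => //.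
  by apply/funext => i; rewrite mulr1.
have NS j : N j `<=` N j.+1.
  by move=> _ [v -> [w Mw <-]]; exists pk => //; exists w => //; exact: powS.
have Nsep j : (j < e')%N -> exists2 f, exists d, f \is d.-homog &
    vanishes (N j) f /\ ~ vanishes (N j.+1) f.
  move=> /e'min /sep[f [d fd] [fv fnv]].
  have twK (w : 'I_n.+1 -> K) : (twist (fun i => (pk i)^-1) f).@[fun i => pk i * w i] = f.@[w].
    by rewrite meval_twist; apply: meval_eq => i; rewrite mulKf.
  exists (twist (fun i => (pk i)^-1) f); first by exists d; exact: twist_homog.
  split; first by move=> _ [_ -> [w Mw <-]]; rewrite twK fv.
  move=> tv; apply: fnv => w Mw; rewrite -twK; apply: tv.
  by exists pk => //; exists w.
have powA j w : hpow M j w -> hpow A j (fun i => p i ^+ j * w i).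
  elim: j w => [|j IH] w /=; first by move=> ->; apply/funext => i; rewrite mulr1.
  move=> [_ [_ -> [a Aa <-]] [w' Mw' <-]]; exists a => //.
  exists (fun i => p i ^+ j * w' i); first exact: IH.
  apply/funext => i; rewrite exprS -/(q i) /q.
  by rewrite mulrACA mulVKf // mulrCA mulrA.
have NA j : (j <= k)%N -> N j `<=` hpow A k.
  move=> jk _ [_ -> [w /powA Aw <-]].
  have -> : (fun i => pk i * w i) = (fun i => p i ^+ (k - j) * (p i ^+ j * w i)).
    by apply/funext => i; rewrite mulrA -exprD subnK.
  rewrite -{1}(subnK jk); elim: (k - j)%N => [|l IH].
    rewrite add0n.
    suff -> : (fun i => p i ^+ 0 * (p i ^+ j * w i)) = (fun i => p i ^+ j * w i) by [].
    by apply/funext => i; rewrite mul1r.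
  exists p => //; exists (fun i => p i ^+ l * (p i ^+ j * w i)) => //.
  by apply/funext => i; rewrite exprS mulrA.
have e'n : (e' <= n)%N.
  apply: (@chain_length_le_growth K n.+1 N) => //.
  - by move=> i _; have [v Nv v0] := Nnz i; exists v => //; exists ord0.
  - by apply: growth_subset (spanned_growthW (spanned_growth_setT K n)).
have e'E : e' = e.
  apply/eqP; rewrite eqn_leq leq_min e'n e'k /=.
  case: e'max => [->|e'full]; first exact: geq_minr.
  apply: leq_trans (geq_minl _ _) _.
  apply: (@no_form_growth K n (hpow M e')) => //.
  by apply: spanned_growthW; exact: spanned_growth_pow.
by rewrite -e'E; exists N; split=> //; exact: NA.
Qed.

End HadamardChain.

(** * Two linear forms without common zero *)

(** Suppose that on [A] a power of each coordinate lies in the ideal of [l0] and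
[l1].  Then the ring of functions on [A] defined by polynomials is generated, as
a module over the polynomials in [l0] and [l1], by monomials of bounded degree
[B]; as there are [d.+1] monomials of degree [d] in two variables, the Hilbert
function is at most linear. *)
Lemma finite_module_growth (K : fieldType) n (A : set ('I_n.+1 -> K))
    (l0 l1 : {mpoly K[n.+1]}) (N : 'I_n.+1 -> nat) :
  (forall i, exists h0 h1, [/\ h0 \is (N i).-homog, h1 \is (N i).-homog &
    forall v, A v -> v i ^+ (N i).+1 = h0.@[v] * l0.@[v] + h1.@[v] * l1.@[v]]) ->
  spanned_growth A 1.
Proof.
move=> hN; pose B := (\sum_i N i)%N.
(* The degree-d part is spanned by the l0^j * l1^(d - j - |x|) * X^x. *)
pose basis (d : nat) v (j : nat) (x : 'X_{1..n.+1 < B.+1}) : K :=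
  if (j + mdeg x <= d)%N then l0.@[v] ^+ j * l1.@[v] ^+ (d - j - mdeg x) * 'X_[x].@[v] else 0.
pose spanned d (f : {mpoly K[n.+1]}) := exists c : nat -> 'X_{1..n.+1 < B.+1} -> K,
  forall v, A v -> f.@[v] = \sum_(j < d.+1) \sum_x c j x * basis d v j x.
have spannedD d f g : spanned d f -> spanned d g -> spanned d (f + g).
  move=> [c cP] [c' cP']; exists (fun j x => c j x + c' j x) => v Av.
  rewrite mevalD cP // cP' // -big_split; apply: eq_bigr => j _; rewrite -big_split.
  by apply: eq_bigr => x _; rewrite mulrDl.
have spannedZ d a f : spanned d f -> spanned d (a *: f).
  move=> [c cP]; exists (fun j x => a * c j x) => v Av.
  rewrite mevalZ cP // mulr_sumr; apply: eq_bigr => j _; rewrite mulr_sumr.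
  by apply: eq_bigr => x _; rewrite mulrA.
have spanned_homog d : (forall m, mdeg m = d -> spanned d 'X_[m]) ->
    forall f, f \is d.-homog -> spanned d f.
  move=> mP f /dhomogP fd; rewrite (mpolyE f) big_seq.
  elim/big_rec: _ => [|m g mf gd].
    exists (fun _ _ => 0) => v _; rewrite meval0 big1 // => j _.
    by rewrite big1 // => x _; rewrite mul0r.
  by apply: spannedD => //; apply: spannedZ; apply: mP; exact: fd.
have spanned_mul0 d f : spanned d f -> spanned d.+1 (f * l0).
  move=> [c cP]; exists (fun j x => if j is j'.+1 then c j' x else 0) => v Av.
  rewrite big_ord_recl big1 ?add0r => [|x _]; last by rewrite mul0r.
  rewrite mevalM cP // mulr_suml; apply: eq_bigr => j _; rewrite mulr_suml.
  apply: eq_bigr => x _; rewrite /= -mulrA; congr (_ * _).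
  rewrite /basis /bump /= add1n addSn ltnS; case: ifP => _; last by rewrite mul0r.
  by rewrite subSS exprS mulrC !mulrA.
have spanned_mul1 d f : spanned d f -> spanned d.+1 (f * l1).
  move=> [c cP].
  exists (fun j (x : 'X_{1..n.+1 < B.+1}) =>
    if (j + mdeg x <= d)%N then c j x else 0) => v Av.
  rewrite big_ord_recr /= [X in _ + X]big1 ?addr0 => [|x _]; last first.
    by rewrite leqNgt ltnS leq_addr /= mul0r.
  rewrite mevalM cP // mulr_suml; apply: eq_bigr => j _; rewrite mulr_suml.
  apply: eq_bigr => x _; rewrite /basis; case: ifP => jx; last by rewrite mulr0 !mul0r.
  rewrite leqW // -[_ * _ * l1.@[v]]mulrA; congr (_ * _).
  have -> : (d.+1 - j - mdeg x = (d - j - mdeg x).+1)%N by lia.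
  by rewrite exprS; ring.
have spanned_low d m : mdeg m = d -> (d < B.+1)%N -> spanned d 'X_[m].
  move=> md dB; have mB : (mdeg m < B.+1)%N by rewrite md.
  exists (fun j (x : 'X_{1..n.+1 < B.+1}) => ((j == 0%N) && (bmnm x == m))%:R) => v Av.
  rewrite big_ord_recl [X in _ + X]big1 ?addr0 => [|j _]; last first.
    by rewrite big1 // => x _; rewrite mul0r.
  rewrite (bigD1 (BMultinom mB)) //= eqxx big1 ?addr0 => [|x xm].
    by rewrite /basis /= add0n md leqnn subn0 subnn !expr0 !mul1r.
  by rewrite -(bmeqP x (BMultinom mB)) (negPf xm) mul0r.
have spanned_mon d m : mdeg m = d -> spanned d 'X_[m].
  elim: d m => [|d IH] m md; first exact: spanned_low.
  have [dB|Bd] := ltnP d.+1 B.+1; first exact: spanned_low.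
  (* A monomial of degree more than B is divisible by some 'X_i ^+ (N i).+1. *)
  have [i Nm] : exists i, (N i < m i)%N.
    apply: contrapT => no; move: Bd; rewrite -md mdegE ltnNge => /negP; apply.
    by apply: leq_sum => i _; rewrite leqNgt; apply/negP => Ni; apply: no; exists i.
  have [h0 [h1 [h0d h1d hE]]] := hN i.
  pose m' := (m - U_(i) *+ (N i).+1)%MM.
  have le : (U_(i) *+ (N i).+1 <= m)%MM.
    by apply/mnm_lepP => y; rewrite mulmnE mnm1E; case: eqP => [<-|_]; rewrite ?mul1n ?mul0n.
  have mE : m = (m' + U_(i) *+ (N i).+1)%MM by rewrite submK.
  have m'd : (mdeg m' + N i = d)%N.
    by move: md; rewrite mE mdegD mdegMn mdeg1 mul1n addnS => -[].
  have homm' h : h \is (N i).-homog -> 'X_[m'] * h \is d.-homog.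
    by move=> hd; rewrite -m'd; apply: dhomogM => //; rewrite dhomogX.
  have [c cP] : spanned d.+1 ('X_[m'] * h0 * l0 + 'X_[m'] * h1 * l1).
    apply: spannedD; [apply: spanned_mul0|apply: spanned_mul1];
      by apply: (spanned_homog _ IH); exact: homm'.
  exists c => v Av; rewrite -cP // mE mpolyXD -mpolyXn mevalD !mevalM rmorphXn /= mevalXU hE //.
  by rewrite mulrDr !mulrA.
exists #|{: 'X_{1..n.+1 < B.+1}}| => d; exists ('I_d.+1 * 'X_{1..n.+1 < B.+1})%type.
split; first by rewrite card_prod card_ord expn1 mulnC.
have /choice[c cP] : forall m : 'X_{1..n.+1}, exists c : nat -> 'X_{1..n.+1 < B.+1} -> K,
    mdeg m = d -> forall v, A v ->
    'X_[m].@[v] = \sum_(j < d.+1) \sum_x c j x * basis d v j x.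
  move=> m; have [md|nmd] := eqVneq (mdeg m) d.
    by have [c cP] := spanned_mon d m md; exists c.
  by exists (fun _ _ => 0) => md; rewrite md eqxx in nmd.
pose T := ('I_d.+1 * 'X_{1..n.+1 < B.+1})%type.
exists (fun m (jx : T) => c m jx.1 jx.2) => v Av.
exists (fun jx : T => basis d v jx.1 jx.2) => m md.
by rewrite (cP m md v Av) pair_bigA.
Qed.

Lemma poly_eq_horner (K : numFieldType) (p q : {poly K}) :
  (forall x, p.[x] = q.[x]) -> p = q.
Proof.
move=> pq; apply/eqP; rewrite -subr_eq0; apply/negPn/negP => pq0.
have : (size [seq i%:R : K | i <- iota 0 (size (p - q)%R)] < size (p - q)%R)%N.
  apply: max_poly_roots => //.
    by apply/allP => x _; rewrite rootE hornerD hornerN pq subrr.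
  rewrite map_inj_uniq ?iota_uniq // => i j /eqP.
  by rewrite eqr_nat => /eqP.
by rewrite size_map size_iota ltnn.
Qed.

Lemma meval_pihomog (K : fieldType) n (f : {mpoly K[n]}) (v : 'I_n -> K) c :
  f.@[fun i => c * v i] = \sum_(d < msize f) c ^+ d * (pihomog mdeg d f).@[v].
Proof.
rewrite [f in LHS](pihomog_partitionE (leqnn (msize f))) raddf_sum /=.
by apply: eq_bigr => d _; rewrite (meval_scale _ _ (pihomogP _ _ _)).
Qed.

(** On the line through [v] both sides are polynomials in the parameter [c]; the
coefficients of [c ^+ N.+1] are compared. *)
Lemma homogeneous_combination (K : numFieldType) n (g h0 h1 l0 l1 : {mpoly K[n]}) N v :
  g \is N.+1.-homog -> l0 \is 1.-homog -> l1 \is 1.-homog ->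
  (forall c, g.@[fun i => c * v i] = h0.@[fun i => c * v i] * l0.@[fun i => c * v i] +
                                      h1.@[fun i => c * v i] * l1.@[fun i => c * v i]) ->
  g.@[v] = (pihomog mdeg N h0).@[v] * l0.@[v] + (pihomog mdeg N h1).@[v] * l1.@[v].
Proof.
move=> gd l0d l1d gE.
pose P (h l : {mpoly K[n]}) : {poly K} :=
  \poly_(d < msize h) (pihomog mdeg d h).@[v] * l.@[v]%:P * 'X.
have PE h l c : l \is 1.-homog -> (P h l).[c] = h.@[fun i => c * v i] * l.@[fun i => c * v i].
  move=> ld; rewrite meval_pihomog (meval_scale _ _ ld) expr1 /P.
  rewrite !hornerM hornerX hornerC horner_poly.
  rewrite -mulrA [l.@[v] * c]mulrC; congr (_ * _).
  by apply: eq_bigr => d _; rewrite mulrC.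
have Pcoef h l : (P h l)`_N.+1 = (pihomog mdeg N h).@[v] * l.@[v].
  rewrite /P coefMX /= coefMC coef_poly; case: ltnP => // hN.
  rewrite [pihomog mdeg N h]big1_seq ?meval0 // => m /andP[/eqP mN mh].
  by have := msize_mdeg_lt mh; rewrite ltnNge mN hN.
have : g.@[v] *: 'X^(N.+1) = P h0 l0 + P h1 l1.
  apply: poly_eq_horner => c; rewrite hornerD !PE // -gE (meval_scale _ _ gd).
  by rewrite hornerZ hornerXn mulrC.
move=> /(congr1 (fun p : {poly K} => p`_N.+1)).
by rewrite coefZ coefXn eqxx mulr1 coefD !Pcoef.
Qed.

(** If the closed cone defined by [A] meets the common zeros of [l0] and [l1] only
at the origin, a power of each coordinate is on [A] a combination of [l0] and
[l1]. *)
Lemma base_point_free_powers (R : realType) n (A : set ('I_n -> R[i])) (l0 l1 : {mpoly R[i][n]}) :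
  l0 \is 1.-homog -> l1 \is 1.-homog ->
  (forall b, (forall d f, f \is d.-homog -> vanishes A f -> f.@[b] = 0) ->
     l0.@[b] = 0 -> l1.@[b] = 0 -> forall i, b i = 0) ->
  forall i, exists N h0 h1, [/\ h0 \is N.-homog, h1 \is N.-homog &
    forall v, A v -> v i ^+ N.+1 = h0.@[v] * l0.@[v] + h1.@[v] * l1.@[v]].
Proof.
move=> l0d l1d nozero i.
pose J := [set f : {mpoly R[i][n]} | exists h0 h1, forall v c, A v ->
   f.@[fun j => c * v j] = h0.@[fun j => c * v j] * l0.@[fun j => c * v j] +
                           h1.@[fun j => c * v j] * l1.@[fun j => c * v j]].
have Jid : is_ideal J.
  split.
  - by exists 0, 0 => v c _ /=; rewrite !meval0 !mul0r addr0.
  - move=> f g [h0 [h1 fE]] [k0 [k1 gE]]; exists (h0 + k0), (h1 + k1) => v c Av /=.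
    by rewrite !mevalD (fE v c Av) (gE v c Av); ring.
  - move=> h f [h0 [h1 fE]]; exists (h * h0), (h * h1) => v c Av /=.
    by rewrite !mevalM (fE v c Av); ring.
have [[N [h0 [h1 NE]]]|no] := EM (exists N, J ('X_i ^+ N)); last first.
  have Jpow N : ~ J ('X_i ^+ N) by move=> JN; apply: no; exists N.
  have [b bJ] := nullstellensatz (@complex_uncountable R) Jid Jpow.
  rewrite mevalXU nozero ?eqxx //.
  - move=> d f fd fA; apply: bJ; exists 0, 0 => v c Av /=.
    by rewrite (meval_scale _ _ fd) fA // mulr0 !meval0 !mul0r addr0.
  - by apply: bJ; exists 1, 0 => v c _ /=; rewrite meval1 meval0 mul1r mul0r addr0.
  - by apply: bJ; exists 0, 1 => v c _ /=; rewrite meval1 meval0 mul1r mul0r add0r.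
(* The factor 'X_i makes the exponent positive. *)
exists N, (pihomog mdeg N ('X_i * h0)), (pihomog mdeg N ('X_i * h1)).
split; [exact: pihomogP|exact: pihomogP|move=> v Av].
have -> : v i ^+ N.+1 = ('X_i ^+ N.+1).@[v] by rewrite rmorphXn /= mevalXU.
apply: homogeneous_combination => // [|c /=].
  by rewrite -[X in X.-homog]mul1n; apply: dhomogMn; rewrite dhomogX /= mdeg1.
by rewrite exprS !mevalM (NE v c Av); ring.
Qed.

(** * Closed sets of the projective space and their cones *)

Section Projective.
Variables (R : realType) (n : nat).
Local Notation C := R[i].
Implicit Types (P Q : Pn R n) (X Z : set (Pn R n)) (N : set ('I_n.+1 -> C)).

Lemma hcoord_neq0 P : exists i, hcoord P i != 0.
Proof. by have /rV0Pn[i Pi] := valP (repr P); exists i. Qed.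

Lemma hcoord_inj P Q c : (forall i, hcoord P i = c * hcoord Q i) -> P = Q.
Proof.
move=> PQ; rewrite -(reprK P) -(reprK Q); apply/esym/eqmodP/asboolP; exists c.
  have [i Pi] := hcoord_neq0 P; apply/eqP => c0.
  by rewrite PQ c0 mul0r eqxx in Pi.
by apply/rowP => i; rewrite mxE; exact: PQ.
Qed.

Lemma point_of_vector (v : 'I_n.+1 -> C) i : v i != 0 ->
  exists P, exists2 c, c != 0 & forall j, hcoord P j = c * v j.
Proof.
move=> vi; have v0 : \row_j v j != 0 by apply/rV0Pn; exists i; rewrite mxE.
pose w : nzvec R n := exist (fun x : 'rV[C]_n.+1 => x != 0) _ v0; have [c c0 cE] := hcoord_pi w.
exists (\pi_(Pn R n) w)%qT, c => // j; by rewrite cE mxE.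
Qed.

(** The vectors of chosen homogeneous coordinates of the points of [X], one for
each point. *)
Definition cone X : set ('I_n.+1 -> C) := [set @hcoord R n P | P in X].

(** The closed set defined by the forms that vanish on [N]: the Zariski closure
of the set of points with homogeneous coordinates in [N]. *)
Definition locus N : set (Pn R n) :=
  [set P | forall d f, f \is d.-homog -> vanishes N f -> f.@[hcoord P] = 0].

Lemma locus_closed N : zariski_closed (locus N).
Proof.
exists [set f | homogeneous f /\ vanishes N f]; first by move=> f [].
apply/seteqP; split=> P PN; first by move=> f [[d fd] fN]; exact: PN fd fN.
by move=> d f fd fN; apply: PN; split=> //; exists d.
Qed.

Lemma locus_subset N M : N `<=` M -> locus N `<=` locus M.
Proof. by move=> NM P PN d f fd fM; apply: PN fd _ => v /NM; exact: fM. Qed.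

Lemma closed_homog_separation X P : zariski_closed X -> ~ X P ->
  exists2 f, exists d, f \is d.-homog & vanishes (cone X) f /\ f.@[hcoord P] <> 0.
Proof.
move=> [S Shom ->] /existsNP[f /not_implyP[Sf fP]]; have [d fd] := Shom f Sf.
exists f; first by exists d.
by split=> // _ [Q XQ <-]; exact: XQ.
Qed.

Lemma locus_cone X : zariski_closed X -> locus (cone X) = X.
Proof.
move=> Xc; apply/seteqP; split=> P; last by move=> XP d f fd; apply; exists P.
move=> PX; apply: contrapT => /(closed_homog_separation Xc)[f [d fd] [fX fP]].
by apply: fP; exact: PX fd fX.
Qed.

Lemma irreducible_prime X : irreducible_closed X -> prime_set (cone X).
Proof.
move=> [Xc _ Xirr] d e f g fd ge fg.
pose V h := locus [set v | h.@[v] = 0].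
have VE h k (P : Pn R n) : h \is k.-homog -> V h P -> h.@[hcoord P] = 0.
  by move=> hk VP; apply: VP hk _ => v.
have [||P XP|Vf|Vg] := Xirr (V f) (V g); [exact: locus_closed|exact: locus_closed| | |].
- have /eqP : (f * g).@[hcoord P] = 0 by apply: fg; exists P.
  rewrite mevalM mulf_eq0 => /orP[]/eqP fP; [left|right] => k h hk; exact.
- by left=> _ [P XP <-]; exact: VE fd (Vf P XP).
- by right=> _ [P XP <-]; exact: VE ge (Vg P XP).
Qed.

Lemma vector_point N v i : N v -> v i != 0 -> exists2 P, locus N P &
  exists2 c, c != 0 & forall j, hcoord P j = c * v j.
Proof.
move=> Nv vi; have [P [c c0 Pv]] := point_of_vector vi.
exists P; last by exists c.
by move=> d f fd fN; rewrite (meval_eq _ Pv) (meval_scale _ _ fd) fN // mulr0.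
Qed.

(** The zero vector, which gives no point, may belong to [N]; a form that is
nonzero there is constant, hence nonzero at [u]. *)
Lemma vanishes_locus N d (f : {mpoly C[n.+1]}) :
  f \is d.-homog -> (exists2 u, N u & exists i, u i != 0) ->
  vanishes (cone (locus N)) f -> vanishes N f.
Proof.
move=> fd [u Nu [i ui]] fN v Nv; apply/eqP/negPn/negP => fv.
have nzE w j : N w -> w j != 0 -> f.@[w] = 0.
  move=> Nw wj; have [P NP [c c0 Pw]] := vector_point Nw wj.
  have := fN _ (ex_intro2 _ _ P NP erefl).
  rewrite (meval_eq _ Pw) (meval_scale _ _ fd) => /eqP.
  by rewrite mulf_eq0 expf_eq0 (negPf c0) andbF => /eqP.
have [[j vj]|no] := EM (exists j, v j != 0); first by rewrite (nzE v j) ?eqxx in fv.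
have v0 j : v j = 0 by apply/eqP/negPn/negP => vj; apply: no; exists j.
by move: (fv); rewrite -(meval_dhomog0 u fd v0 fv) (nzE u i) ?eqxx.
Qed.

Lemma locus_irreducible N : prime_set N -> (exists2 u, N u & exists i, u i != 0) ->
  irreducible_closed (locus N).
Proof.
move=> Np [u Nu [i ui]]; split; first exact: locus_closed.
  by have [P NP _] := vector_point Nu ui; exists P.
move=> Z1 Z2 Z1c Z2c NZ; apply: contrapT => /not_orP[].
move=> /existsNP[P /not_implyP[NP /(closed_homog_separation Z1c)[f [d fd] [fZ fP]]]].
move=> /existsNP[Q /not_implyP[NQ /(closed_homog_separation Z2c)[g [e ge] [gZ gQ]]]].
have [|fN|gN] := Np _ _ f g fd ge.
- apply: (vanishes_locus (dhomogM fd ge)); first by exists u => //; exists i.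
  move=> _ [T NT <-]; rewrite mevalM; have [ZT|ZT] := NZ T NT.
    by rewrite fZ ?mul0r //; exists T.
  by rewrite gZ ?mulr0 //; exists T.
- by apply: fP; exact: NP fd fN.
- by apply: gQ; exact: NQ ge gN.
Qed.

Lemma growth_locus N r : growth N r -> growth (cone (locus N)) r.
Proof.
move=> [D DP]; exists D => d I f fd DI; have [c c0 cN] := DP d I f fd DI.
exists c => // _ [P NP <-]; apply: NP cN; apply: rpred_sum => i _; exact: dhomogZ.
Qed.

Lemma irreducible_chain_le X e r (Z : nat -> set (Pn R n)) :
  growth (cone X) r -> irreducible_chain X e Z -> (e <= r)%N.
Proof.
move=> Xgrow [Zirr Zlt ZX].
apply: (@chain_length_le_growth _ _ (fun i => cone (Z i))).
- by move=> i ie; apply: irreducible_prime; exact: Zirr.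
- move=> i ie; have [_ [P ZP] _] := Zirr i ie; exists (hcoord P); first by exists P.
  exact: hcoord_neq0.
- by move=> i /Zlt[sub _] _ [P ZP <-]; exists P => //; exact: sub.
- move=> i ie; have [sub nsub] := Zlt i ie.
  have [Zc _ _] := Zirr i (ltnW ie).
  have /existsNP[P /not_implyP[ZP /(closed_homog_separation Zc)[f [d fd] [fZ fP]]]] := nsub.
  exists f; first by exists d.
  by split=> // fZ'; apply: fP; apply: fZ'; exists P.
- by apply: growth_subset Xgrow => _ [P ZP <-]; exists P => //; exact: ZX.
Qed.

Lemma closed_setI X Z : zariski_closed X -> zariski_closed Z -> zariski_closed (X `&` Z).
Proof.
move=> [S Sh ->] [T Th ->]; exists (S `|` T); first by move=> f [/Sh|/Th].
apply/seteqP; split=> P; first by move=> [SP TP] f [/SP|/TP].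
by move=> STP; split=> f ?; apply: STP; [left|right].
Qed.

Lemma closed_set1 P : zariski_closed [set P].
Proof.
have [i Pi] := hcoord_neq0 P.
exists [set f | exists j, f = hcoord P i *: 'X_j - hcoord P j *: 'X_i].
  move=> _ [j ->]; exists 1%N; apply: rpredB; apply: dhomogZ; by rewrite dhomogX /= mdeg1.
apply/seteqP; split=> [_ -> _ [j ->]|Q QP].
  by rewrite mevalB !mevalZ !mevalXU mulrC subrr.
apply: (@hcoord_inj _ _ (hcoord Q i / hcoord P i)) => j.
have := QP _ (ex_intro _ j erefl); rewrite mevalB !mevalZ !mevalXU => /eqP.
by rewrite subr_eq0 mulrAC => /eqP e; apply: (mulfI Pi); rewrite e mulrCA divff // mulr1 mulrC.
Qed.

Lemma irreducible_set1 P : irreducible_closed [set P].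
Proof.
split; [exact: closed_set1 | by exists P | move=> Z1 Z2 _ _ /(_ P erefl)].
by move=> [ZP|ZP]; [left|right] => _ ->.
Qed.

(** By the descending chain condition. *)
Lemma minimal_infinite_closed X : zariski_closed X -> infinite_set X ->
  exists W, [/\ zariski_closed W, infinite_set W, W `<=` X &
    forall Z, zariski_closed Z -> infinite_set Z -> Z `<=` W -> W `<=` Z].
Proof.
move=> Xc Xinf; apply: contrapT => no.
pose good W := [/\ zariski_closed W, infinite_set W & W `<=` X].
have /choice[next nextP] : forall W, exists Z, good W -> good Z /\ Z `<` W.
  move=> W; have [[Wc Winf WX]|] := EM (good W); last by exists W.
  apply: contrapT => noZ; apply: no; exists W; split=> // Z Zc Zinf ZW.
  apply: contrapT => nWZ; apply: noZ; exists Z => _; split; last by split.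
  by split=> //; exact: subset_trans ZW WX.
pose W := fix W i := if i is j.+1 then next (W j) else X.
have Wgood i : good (W i) by elim: i => [|i IH]; [split | have [] := nextP _ IH].
apply: (@descending_vanishing_sets _ _ (fun i => cone (W i))).
  move=> i _ [P WP <-]; exists P => //; have [_ [sub _]] := nextP _ (Wgood i); exact: sub.
move=> i; have [[nc _ _] [_ nsub]] := nextP _ (Wgood i).
have /existsNP[P /not_implyP[WP /(closed_homog_separation nc)[f _ [fZ fP]]]] := nsub.
exists f => // fW; apply: fP; apply: fW; by exists P.
Qed.

(** A minimal infinite closed subset [W] of [Z] is irreducible, so that a point of
[W], then [W] and [Y] would form a chain of length 2. *)
Lemma proper_closed_finite Y Z : irreducible_closed Y ->
  (forall e W, irreducible_chain Y e W -> (e <= 1)%N) ->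
  zariski_closed Z -> Z `<=` Y -> ~ (Y `<=` Z) -> finite_set Z.
Proof.
move=> Yirr Ydim Zc ZY YZ; apply: contrapT => Zinf.
have [W [Wc Winf WZ Wmin]] := minimal_infinite_closed Zc Zinf.
have [P WP] : W !=set0 by apply: infinite_setN0.
have Wirr : irreducible_closed W.
  split=> //; first by exists P.
  move=> Z1 Z2 Z1c Z2c WZ12.
  have [W1|W1] := EM (finite_set (W `&` Z1)); last first.
    by left => Q /(Wmin _ (closed_setI Wc Z1c) W1 (@subIsetl _ _ _))[].
  have [W2|W2] := EM (finite_set (W `&` Z2)); last first.
    by right => Q /(Wmin _ (closed_setI Wc Z2c) W2 (@subIsetl _ _ _))[].
  case: Winf; apply: (@sub_finite_set _ _ ((W `&` Z1) `|` (W `&` Z2))).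
    by move=> Q WQ; have [ZQ|ZQ] := WZ12 Q WQ; [left|right].
  by rewrite finite_setU.
suff : (2 <= 1)%N by [].
apply: (Ydim 2%N (fun i => if i is i'.+1 then if i' is _.+1 then Y else W else [set P])).
split=> [[|[|i]] //= _|[|[|i]] //= _|//].
- exact: irreducible_set1.
- split; first by move=> _ ->.
  by move=> WP1; apply: Winf; apply: sub_finite_set WP1 _.
- split; first exact: subset_trans WZ ZY.
  by move=> YW; apply: YZ; exact: subset_trans YW WZ.
Qed.

(** The coefficients are the powers of some [t] that is not a root of any of the
polynomials whose coefficients are the coordinates of the points of [Z]. *)
Lemma linear_form_avoiding Z : finite_set Z ->
  exists2 l : {mpoly C[n.+1]}, l \is 1.-homog & forall P, Z P -> l.@[hcoord P] != 0.
Proof.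
move=> /finite_seqP[s ->].
pose q P : {poly C} := \poly_(i < n.+1) hcoord P (inord i).
have q0 : \prod_(P <- s) q P != 0.
  rewrite prodf_seq_neq0; apply/allP => P _ /=.
  have [i Pi] := hcoord_neq0 P; apply: contraNneq Pi => qP.
  by have := congr1 (fun p : {poly C} => p`_i) qP; rewrite coef_poly ltn_ord inord_val coef0 => ->.
have [t qt] : exists t, (\prod_(P <- s) q P).[t] != 0.
  apply: contrapT => no; move/eqP: q0; apply; apply: poly_eq_horner => t.
  by rewrite horner0; apply/eqP/negPn/negP => qt; apply: no; exists t.
exists (\sum_(i < n.+1) t ^+ i *: 'X_i).
  by apply: rpred_sum => i _; apply: dhomogZ; rewrite dhomogX /= mdeg1.
move=> P /= Ps; move: qt; rewrite horner_prod prodf_seq_neq0 => /allP/(_ P Ps) /=.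
rewrite horner_poly raddf_sum /=; congr (_ != 0); apply: eq_bigr => i _.
by rewrite mevalZ mevalXU inord_val mulrC.
Qed.

(** [Y] meets the hyperplane of the first coordinate in finitely many points, so
there is a second linear form without zeros among these points. *)
Lemma curve_spanned_growth Y : irreducible_closed Y ->
  (forall e W, irreducible_chain Y e W -> (e <= 1)%N) ->
  ~ (Y `<=` coord_hyperplane ord0) -> spanned_growth (cone Y) 1.
Proof.
move=> Yirr Ydim YH; have [Yc _ _] := Yirr.
pose l0 : {mpoly C[n.+1]} := 'X_ord0.
have l0d : l0 \is 1.-homog by rewrite dhomogX /= mdeg1.
pose H := locus [set v | l0.@[v] = 0].
have HE P : hcoord P ord0 = 0 -> H P.
  by move=> P0 d f fd; apply; rewrite /= mevalXU.
have HE' P : H P -> hcoord P ord0 = 0.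
  by move=> HP; rewrite -(mevalXU (hcoord P) ord0); apply: HP l0d _ => v.
have Zfin : finite_set (Y `&` H).
  apply: (proper_closed_finite Yirr Ydim).
  - by apply: closed_setI => //; exact: locus_closed.
  - by move=> P [].
  - by move=> YYH; apply: YH => P /YYH[_ /HE'].
have [l1 l1d l1Z] := linear_form_avoiding Zfin.
have [|N0 N0P] := choice (base_point_free_powers (A := cone Y) l0d l1d _); last first.
  exact: finite_module_growth N0P.
move=> b bY l0b l1b i; apply/eqP/negPn/negP => bi.
have [P [c c0 Pb]] := point_of_vector bi.
have YP : Y P.
  rewrite -(locus_cone Yc) => d f fd fY.
  by rewrite (meval_eq _ Pb) (meval_scale _ _ fd) (bY d) // mulr0.
have [] := negP (l1Z P _).
  by split=> //; apply: HE; rewrite Pb -(mevalXU b) -/l0 l0b mulr0.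
by rewrite (meval_eq _ Pb) (meval_scale _ _ l1d) l1b mulr0.
Qed.

Lemma hpow_coneP Y k v : hpow (cone Y) k v <->
  exists2 P : 'I_k -> Pn R n, forall j, Y (P j) &
    v = fun i => \prod_(j < k) hcoord (P j) i.
Proof.
elim: k v => [|k IH] v.
  split=> [->|[P _ ->]]; last by apply/funext => i; rewrite big_ord0.
  have P : 'I_0 -> Pn R n by case.
  by exists P; [case | apply/funext => i; rewrite big_ord0].
split=> [[_ [P0 YP0 <-] [w /IH[P YP ->] <-]]|[P YP ->]].
  exists (fun j => oapp P P0 (unlift ord0 j)).
    by move=> j; case: (unlift ord0 j) => /=.
  apply/funext => i; rewrite big_ord_recl unlift_none /=.
  by congr (_ * _); apply: eq_bigr => j _; rewrite liftK.
exists (hcoord (P ord0)); first by exists (P ord0).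
exists (fun i => \prod_(j < k) hcoord (P (lift ord0 j)) i).
  by apply/IH; exists (fun j => P (lift ord0 j)).
by apply/funext => i; rewrite big_ord_recl.
Qed.

Lemma hadamard_some k (P : 'I_k -> Pn R n) Q : hadamard P = Some Q ->
  exists2 c, c != 0 & forall i, hcoord Q i = c * \prod_(j < k) hcoord (P j) i.
Proof.
rewrite /hadamard; case: insubP => //= w _ wE [<-].
have [c c0 cE] := hcoord_pi w; exists c => // i; rewrite cE; congr (_ * _).
by have -> : val w = _ := wE; rewrite mxE.
Qed.

Lemma hadamard_defined k (P : 'I_k -> Pn R n) i : \prod_(j < k) hcoord (P j) i != 0 ->
  exists Q, hadamard P = Some Q.
Proof.
move=> Pi; rewrite /hadamard; case: insubP => [w _ _|] /=; first by eexists.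
by move=> /negPn/eqP/rowP/(_ i); rewrite !mxE => /eqP; rewrite (negPf Pi).
Qed.

Lemma hadamard_power_locus Y k : (exists2 u, hpow (cone Y) k u & exists i, u i != 0) ->
  hadamard_power Y k = locus (hpow (cone Y) k).
Proof.
move=> [u Yu [iu ui]].
apply/seteqP; split=> P.
  apply; first exact: locus_closed.
  move=> Q [T YT TQ] d f fd fN; have [c c0 cE] := hadamard_some TQ.
  rewrite (meval_eq _ cE) (meval_scale _ _ fd) fN ?mulr0 //.
  by apply/hpow_coneP; exists T.
move=> PN Z [S Shom ->] SZ f Sf; have [d fd] := Shom f Sf.
apply: PN (fd) _.
have nz v i : hpow (cone Y) k v -> v i != 0 -> f.@[v] = 0.
  move=> /hpow_coneP[T YT ->] Ti; have [Q TQ] := hadamard_defined Ti.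
  have [c c0 cE] := hadamard_some TQ.
  have := SZ Q (ex_intro2 _ _ T YT TQ) f Sf.
  rewrite (meval_eq _ cE) (meval_scale _ _ fd) => /eqP.
  by rewrite mulf_eq0 expf_eq0 (negPf c0) andbF => /eqP.
move=> v Yv; apply/eqP/negPn/negP => fv.
have [[j vj]|no] := EM (exists j, v j != 0); first by rewrite (nz v j) ?eqxx in fv.
have v0 j : v j = 0 by apply/eqP/negPn/negP => vj; apply: no; exists j.
by move: (fv); rewrite -(meval_dhomog0 u fd v0 fv) (nz u iu) ?eqxx.
Qed.

End Projective.

(** * The dimension of Hadamard powers *)

Theorem corollary1p5 (R : realType) (n : nat) (Y : set (Pn R n))
    (hY : integral_curve Y)
    (hDelta : ~ (Y `<=` @coord_hyperplanes R n))
    (hbinomial : forall B : set (Pn R n), binomial_hypersurface B -> ~ (Y `<=` B))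
    (k : nat) (hk : (1 <= k)%N) :
  has_dim (hadamard_power Y k) (minn n k).
Proof.
have [Yirr [_ Ydim]] := hY.
have [p Yp p0] : exists2 p, Y p & forall i, hcoord p i != 0.
  have /existsNP[p /not_implyP[Yp Hp]] := hDelta; exists p => // i.
  by apply/negP => /eqP pi0; apply: Hp; exists i.
have Aprime : prime_set (cone Y) by exact: irreducible_prime.
have Agrow : spanned_growth (cone Y) 1.
  apply: curve_spanned_growth => // YH; have := p0 ord0.
  by rewrite (YH p Yp) eqxx.
have binom (m m' : 'X_{1..n.+1}) (a b : R[i]) : a != 0 -> b != 0 -> m != m' ->
    mdeg m = mdeg m' -> ~ vanishes (cone Y) (a *: 'X_[m] + b *: 'X_[m']).
  move=> a0 b0 mm' dmm' van; apply: (hbinomial _ _).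
    by exists a, b, m, m'.
  by move=> P YP f ->; apply: van; exists P.
have [N [Nprime Nnz Nsub Nsep NA]] :=
  hadamard_power_chain k Aprime (ex_intro2 _ _ p Yp erefl) p0 Agrow binom.
have Nnz1 i : (i <= minn n k)%N -> exists2 u, N i u & exists j, u j != 0.
  by move=> /Nnz[u Nu u0]; exists u => //; exists ord0.
rewrite hadamard_power_locus; last first.
  by have [u Nu u0] := Nnz1 _ (leqnn _); exists u => //; exact: NA.
split.
  exists (fun i => locus (N i)); split=> [i ie|i ie|].
  - by apply: locus_irreducible; [exact: Nprime | exact: Nnz1].
  - split; first exact/locus_subset/Nsub.
    have [f [d fd] [fN fN']] := Nsep i ie => sub; apply: fN'.
    apply: (vanishes_locus fd (Nnz1 _ ie)) => _ [P /sub PN <-].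
    exact: PN fd fN.
  - exact: locus_subset.
move=> e Z Zchain; rewrite leq_min; apply/andP; split.
  apply: irreducible_chain_le Zchain.
  by apply: growth_subset (spanned_growthW (spanned_growth_setT R[i] n)).
apply: irreducible_chain_le Zchain; apply: growth_locus.
exact/spanned_growthW/spanned_growth_pow.
Qed.
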